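(* Let $\mathbf{A}\in\mathbb{R}^{n\times d}$ and let $\mathbf{B}\in\mathbb{R}^{n\times d_B}$ have rank $m$. Let $\mathbf{B}\mathbf{B}^{\rm T}=\mathbf{U}\,\mathrm{diag}(b_1,\dots,b_m)\,\mathbf{U}^{\rm T}$ with $\mathbf{U}\in\mathbb{R}^{n\times m}$, $\mathbf{U}^{\rm T}\mathbf{U}=\mathbf{I}_m$, where $b_i$ is the $i$-th largest squared singular value of $\mathbf{B}$. Let $\alpha$ be the largest diagonal element of $\mathbf{U}^{\rm T}\mathbf{A}\mathbf{A}^{\rm T}\mathbf{U}/\|\mathbf{U}^{\rm T}\mathbf{A}\mathbf{A}^{\rm T}\mathbf{U}\|_2$. For $k\in[m-1]$ set $$\delta_k=\frac{\sum_{S\subset[m-1],|S|=k}\mathbf{b}^S}{\sum_{S\subset[m],|S|=k}\mathbf{b}^S}.$$ If $\delta_k\le(1-\sqrt\alpha)^2$, then one can (iteratively) select a subset $\widehat S\subset[d_B]$ of size $k$ with $\mathrm{rank}(\mathbf{B}_{:,\widehat S})=k$ and $$\|\mathbf{A}-\mathbf{B}_{:,\widehat S}\mathbf{B}_{:,\widehat S}^\dagger\mathbf{A}\|_2^2\le\|\mathbf{A}-\mathbf{B}\mathbf{B}^\dagger\mathbf{A}\|_2^2+\varepsilon\,\|\mathbf{B}\mathbf{B}^\dagger\mathbf{A}\|_2^2,$$ where $\varepsilon=\big(\sqrt{\alpha t}+\sqrt{(1-\alpha)(1-t)}\big)^2$ and $t=(1-\sqrt{\delta_k})^2$.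
   Context: $[m]=\{1,\dots,m\}$; for $\mathbf{b}=(b_1,\dots,b_m)$ and $S\subset[m]$, $\mathbf{b}^S=\prod_{i\in S}b_i$. $\mathbf{M}_{:,S}$ denotes the column submatrix indexed by $S$, $\mathbf{M}^\dagger$ the Moore–Penrose pseudoinverse and $\mathbf{M}_{:,S}^\dagger:=(\mathbf{M}_{:,S})^\dagger$. $\|\cdot\|_2$ is the spectral norm. *)

(* Defs.v *)
From HB Require Import structures.
From mathcomp Require Import all_boot all_order all_algebra.
From mathcomp Require Import boolp classical_sets reals.
Set Implicit Arguments. Unset Strict Implicit. Unset Printing Implicit Defensive.
Import Order.TTheory GRing.Theory Num.Theory.
Local Open Scope ring_scope.
Local Open Scope classical_set_scope.

Section Defs.
Variable R : realType.

Definition vnorm (q : nat) (x : 'cV[R]_q) : R := Num.sqrt (\sum_i (x i 0) ^+ 2).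

Definition specnorm (p q : nat) (M : 'M[R]_(p, q)) : R :=
  sup [set vnorm (M *m x) | x in [set x : 'cV[R]_q | vnorm x <= 1]].

Definition is_pinv (p q : nat) (M : 'M[R]_(p, q)) (X : 'M[R]_(q, p)) : Prop :=
  [/\ M *m X *m M = M, X *m M *m X = X,
      (M *m X)^T = M *m X & (X *m M)^T = X *m M].

(* Moore-Penrose pseudoinverse (the unique matrix satisfying the Penrose conditions) *)
Definition pinv (p q : nat) (M : 'M[R]_(p, q)) : 'M[R]_(q, p) :=
  xget 0 (is_pinv M).

(* column submatrix M_{:,S}, columns in increasing order *)
Definition colS (p d : nat) (M : 'M[R]_(p, d)) (S : {set 'I_d}) : 'M[R]_(p, #|S|) :=
  colsub (fun i : 'I_#|S| => @enum_val _ (mem S) i) M.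

End Defs.

(* Main.v *)
(** A subset S of the columns of B is good when (P - P_S) A is small, where P
    and P_S are the orthogonal projections onto the ranges of B and B_S. After
    passing to coordinates in the range of B one has V V^T = diag b =: D for
    V = U^T B, and M = (U^T A)(U^T A)^T normalised so that 0 <= M <= 1; the
    task is to find k independent columns of V such that M <= eps on their
    orthogonal complement.

    Interlacing step. By Cauchy-Binet the determinants det(V_S^T V_S) times the
    characteristic polynomials of M compressed to V_S^perp sum up to the
    coefficient of s^k in det(x - M + s D). Call a symmetric X k-good if the
    k-th derivative of det(X + s D) is positive for s >= 0. If X is k-good then,
    for some column v of V, the compression of X to v^perp is (k-1)-good, and a
    0-good matrix is positive definite; so it suffices that x - M is k-good for
    every x > eps. The choice of v only needs the Rayleigh inequality
    q_v q_w >= q q_vw for q = [s^k] det(. + s D) and rank-one directions v, w,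
    which comes from the Gauss-Lucas theorem on the upper half plane.

    Barrier step. To see that [s^k] det(diag x - M + s D) >= 0, start from the
    product of [s^k] prod_j (y_j + s b_j) and det(diag z - M) and apply the
    operators d/dy_j + d/dz_j followed by y_j := 0, z_j := x_j one after the
    other; every intermediate polynomial is again a coefficient of a
    determinantal pencil, hence satisfies the Rayleigh inequality. This implies
    that the barrier L (p_y + p_z) <= p at y = l1, z = x + l2, L = l1 + l2,
    survives each step. Initially d/dy contributes at most delta / l1 and d/dz
    at most (1 - alpha) / c + alpha / (c - 1) with c = x + l2, and optimising
    l1 and c yields eps. *)

Require Import Defs.
From HB Require Import structures.
From mathcomp Require Import all_boot all_order all_algebra perm.
From mathcomp Require Import boolp reals.
From mathcomp Require functions topology normedtype derive classical_sets.
From mathcomp Require Import polyrcf complex ring lra.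
Set Implicit Arguments. Unset Strict Implicit. Unset Printing Implicit Defensive.
Import Order.TTheory GRing.Theory Num.Theory.
Local Open Scope ring_scope.

(** * Calculus of real polynomials *)

Module Calculus.
Import functions topology normedtype derive numFieldNormedType.Exports.
Section Calculus.
Variable R : realType.
Implicit Types (p f F : {poly R}) (a b s : R).

(** The interval contains [size p] distinct equally spaced points, more roots than a nonzero [p] can
    have. *)
Lemma poly_eq0_on_itv p a b :
  a < b -> (forall x, a <= x <= b -> p.[x] = 0) -> p = 0.
Proof.
move=> ab p0; apply/eqP; apply: contraT => pn0.
pose h := (b - a) / (size p)%:R.
have s0 : 0 < (size p)%:R :> R by rewrite ltr0n lt0n size_poly_eq0.
have h0 : 0 < h by rewrite divr_gt0 // subr_gt0.
pose rs := mkseq (fun i => a + i%:R * h) (size p).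
have rsu : uniq rs.
  rewrite map_inj_uniq ?iota_uniq // => i j /addrI /(mulIf (lt0r_neq0 h0)).
  by move=> /eqP; rewrite eqr_nat => /eqP.
have rsr : all (root p) rs.
  apply/allP => x /mapP[j]; rewrite mem_iota /= add0n => ilt ->.
  apply/eqP/p0; rewrite lerDl mulr_ge0 ?(ltW h0) //= -lerBrDl.
  rewrite -[leRHS](mulfVK (lt0r_neq0 s0)) mulrC ler_wpM2l ?(ltW h0) //.
  by rewrite ler_nat ltnW.
have := max_poly_roots pn0 rsr rsu.
by rewrite size_mkseq ltnn.
Qed.

Lemma poly_ge0_right p a b : a < b ->
  (forall x, a < x < b -> 0 <= p.[x]) -> 0 <= p.[a].
Proof.
move=> ab p_ge0; rewrite leNgt; apply/negP => p0.
have pe : 0 < - p.[a] by rewrite oppr_gt0.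
have [d d0 hd] := poly_cont a p pe.
pose e := Num.min (d / 2) ((b - a) / 2).
have e0 : 0 < e by rewrite lt_min !divr_gt0 ?subr_gt0.
have ed : e <= d / 2 by rewrite ge_min lexx.
have eb : e <= (b - a) / 2 by rewrite ge_min lexx orbT.
have aeb : a < a + e < b by apply/andP; split; lra.
have ed' : `|a + e - a| < d by rewrite addrC addKr gtr0_norm //; lra.
have := le_lt_trans (ler_norm _) (hd _ ed'); have := p_ge0 _ aeb; lra.
Qed.

Lemma poly_ge0_left p a b : a < b ->
  (forall x, a < x < b -> 0 <= p.[x]) -> 0 <= p.[b].
Proof.
move=> ab p_ge0.
have := @poly_ge0_right (p \Po (- 'X)) (- b) (- a).
rewrite horner_comp !hornerE opprK; apply; first by rewrite ltrN2.
move=> x /andP[bx xa]; rewrite horner_comp !hornerE; apply: p_ge0.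
by rewrite ltrNr xa ltrNl bx.
Qed.

Lemma poly_ge0_at0 p : (forall x, 0 < x -> 0 <= p.[x]) -> 0 <= p.[0].
Proof.
by move=> p_ge0; apply: (@poly_ge0_right p 0 1) => // x /andP[/p_ge0].
Qed.

(** The sign of the Wronskian makes the derivative of f/F nonpositive. *)
Lemma wronskian_quot_le f F a b : a <= b ->
  (forall x, a <= x <= b -> 0 < F.[x]) ->
  (forall x, 0 <= f.[x] * F^`().[x] - f^`().[x] * F.[x]) ->
  f.[b] * F.[a] <= f.[a] * F.[b].
Proof.
move=> ab F0 W0.
pose g := (horner f * (fun y => (F.[y])^-1)) : R -> R.
have Fn0 x : a <= x <= b -> F.[x] != 0 by move=> /F0; apply: lt0r_neq0.
have dF x : derivable (horner F) x 1 by exact: derivable_horner.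
have df x : derivable (horner f) x 1 by exact: derivable_horner.
have dV x : a <= x <= b -> derivable (fun y => (F.[y])^-1) x 1.
  by move=> xab; apply: derivableV => //; exact: Fn0.
have dg x : a <= x <= b -> derivable g x 1.
  by move=> xab; apply: derivableM => //; exact: dV.
have itvW x : x \in `]a, b[%R -> a <= x <= b.
  by rewrite in_itv /= => /andP[/ltW -> /ltW ->].
have gle : g b <= g a.
  apply: (@ler0_derive1_le_cc _ g a b) => //.
  - by move=> x /itvW /dg.
  - move=> x /itvW xab; rewrite derive1E deriveM //; last exact: dV.
    rewrite deriveV ?Fn0 // -!derive1E -!derivE.
    rewrite /GRing.scale /= -subr_ge0.
    have -> : 0 - (f.[x] * (- F.[x] ^- 2 * F^`().[x]) + (F.[x])^-1 * f^`().[x])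
      = (f.[x] * F^`().[x] - f^`().[x] * F.[x]) / F.[x] ^+ 2.
      by field; exact: Fn0.
    by rewrite divr_ge0 // sqr_ge0.
  - apply: derivable_within_continuous => x.
    by rewrite in_itv => /= /dg.
  - by rewrite in_itv /= lexx ab.
  - by rewrite in_itv /= lexx ab.
move: gle; rewrite /g /= !fctE.
rewrite ler_pdivrMr ?F0 ?lexx ?ab // mulrAC ler_pdivlMr ?F0 ?lexx ?ab //.
Qed.

(** On [a, oo) the quotient f/F is nonincreasing and tends to 0, since f has smaller degree; hence
    it is nonnegative. A zero of f would force f to vanish from there on. *)
Lemma wronskian_pos f F a :
  (forall x, a <= x -> 0 < F.[x]) ->
  (forall x, 0 <= f.[x] * F^`().[x] - f^`().[x] * F.[x]) ->
  (size f < size F)%N -> 0 < lead_coef F -> f != 0 ->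
  forall x, a <= x -> 0 < f.[x].
Proof.
move=> F0 W0 szf lF fn0.
have qle x y : a <= x -> x <= y -> f.[y] * F.[x] <= f.[x] * F.[y].
  move=> ax xy; apply: wronskian_quot_le => // z /andP[xz _].
  exact/F0/(le_trans ax).
have f_ge0 x : a <= x -> 0 <= f.[x].
  move=> ax; rewrite leNgt; apply/negP => fx.
  (* If f(x) < 0, monotonicity of the quotient keeps f + cF <= 0 to the right of x, against its
     positive leading coefficient. *)
  pose c := - f.[x] / F.[x].
  have c0 : 0 < c by rewrite divr_gt0 ?F0 // oppr_gt0.
  have : 0 < lead_coef (f + c *: F).
    rewrite lead_coefDr; first by rewrite lead_coefZ mulr_gt0.
    by rewrite size_scale // gt_eqF.
  move=> /[dup] l0 /poly_pinfty_gt_lc [n /(_ (Num.max n x))].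
  rewrite le_max lexx => /(_ isT) /(lt_le_trans l0).
  have := qle x (Num.max n x) ax; rewrite le_max lexx orbT => /(_ isT).
  rewrite hornerD hornerZ -ler_pdivlMr ?F0 // => h; rewrite ltNge => /negP; apply.
  by rewrite -lerBrDr sub0r (le_trans h) // /c !mulNr opprK mulrAC.
move=> x ax; rewrite lt_neqAle f_ge0 // andbT; apply/eqP => fx.
move/negP: fn0; apply; apply/eqP; apply: (@poly_eq0_on_itv _ x (x + 1)).
  by rewrite ltrDl.
move=> y /andP[xy _]; apply/eqP; rewrite eq_le f_ge0 ?(le_trans ax) // andbT.
by have := qle x y ax xy; rewrite -fx mul0r pmulr_lle0 // F0.
Qed.

Lemma deriv_pos_lt F a b : (forall x, a <= x -> 0 < F^`().[x]) ->
  a <= b -> forall c, b < c -> F.[b] < F.[c].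
Proof.
move=> F'0 ab c bc.
have h x : x \in `]b, c[ -> 0 < F^`().[x].
  by rewrite in_itv /= => /andP[bx _]; apply/F'0/(le_trans ab)/ltW.
by apply: (derpr h); rewrite in_itv /= bc lexx.
Qed.

(** Here F may start out negative. Let t be the first zero of f. On [0, t) the quotient F/f is
    nondecreasing, which forces F(t) >= 0, and beyond t both F and f are positive. If F(t) > 0, then
    f(t) > 0 as well; if F(t) = 0, both polynomials are divided by X - t. *)
Lemma wronskian_pos_from0 f F :
  (forall x, 0 <= x -> 0 < F^`().[x]) ->
  (forall x, 0 <= f.[x] * F^`().[x] - f^`().[x] * F.[x]) ->
  (size f < size F)%N -> 0 < lead_coef F -> 0 < f.[0] ->
  forall x, 0 <= x -> 0 < f.[x].
Proof.
move=> F'0 W0 szf lF f0 x0 x0_ge0; rewrite ltNge; apply/negP => fx0.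
have fn0 : f != 0 by apply: contraTneq f0 => ->; rewrite horner0 ltxx.
have x0_gt0 : 0 < x0.
  by rewrite lt_neqAle x0_ge0 andbT; apply: contraTneq fx0 => <-; rewrite -ltNge.
have [t t0 [ft ffirst]] : exists2 t, 0 < t & f.[t] = 0 /\
    forall x, 0 <= x < t -> 0 < f.[x].
  have nroot t : {in `]0, t[, forall z, ~~ root f z} ->
      forall x, 0 <= x < t -> 0 < f.[x].
    move=> nr x /andP[x_ge0 xt]; rewrite ltNge; apply/negP => fx.
    have [|y] := @polyrcf.poly_ivt _ f 0 x x_ge0; first by rewrite pmulr_rle0.
    rewrite in_itv /= => /andP[y0 yx] ry; move: y0; rewrite le_eqVlt.
    case/orP => [/eqP y0|y0]; first by move: ry f0; rewrite -y0 => /eqP ->; rewrite ltxx.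
    by have := nr y; rewrite in_itv /= y0 (le_lt_trans yx xt) ry => /(_ isT).
  case: (next_rootP f 0 x0) => [f00|y _ fy yin /nroot nr|c _ _ /nroot nr].
  - by rewrite f00 eqxx in fn0.
  - by exists y => //; move: yin; rewrite in_itv /= => /andP[].
  - exists x0 => //; split=> //; apply/eqP; rewrite eq_le fx0 /=.
    apply: (poly_ge0_left x0_gt0) => z /andP[z0 zx].
    by apply/ltW/nr; rewrite (ltW z0).
(* Nonnegativity of [h] on (0, t) says that F/f stays above its value at 0. *)
pose h := f.[0] *: F - F.[0] *: f.
have h_ge0 x : 0 < x < t -> 0 <= h.[x].
  move=> /andP[x_gt0 xt]; rewrite !hornerE subr_ge0 mulrC [leRHS]mulrC.
  have := @wronskian_quot_le (- F) f 0 x (ltW x_gt0).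
  rewrite !hornerE derivN => H.
  suff : - F.[x] * f.[0] <= - F.[0] * f.[x] by lra.
  apply: H => y; last by rewrite !hornerE; have := W0 y; lra.
  by move=> /andP[y0 yx]; apply: ffirst; rewrite y0 (le_lt_trans yx).
have Ft : 0 <= F.[t].
  have := poly_ge0_left t0 h_ge0.
  by rewrite !hornerE ft mulr0 subr0 pmulr_rge0.
have Fgt x : t < x -> 0 < F.[x].
  by move=> /(deriv_pos_lt F'0 (ltW t0)); apply: le_lt_trans.
have fgt x : t < x -> 0 < f.[x].
  move=> tx; apply: (@wronskian_pos f F x) => // y xy.
  exact/Fgt/(lt_le_trans tx).
move: Ft; rewrite le_eqVlt => /orP[/eqP/esym Ft|Ft]; last first.
  suff : 0 < f.[t] by rewrite ft ltxx.
  apply: (@wronskian_pos f F t) => // x.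
  by rewrite le_eqVlt => /orP[/eqP <-|/Fgt].
(* At a common zero, G(t) = F'(t) > 0 and g(t) >= 0 from the right, while h >= 0 on the left gives
   F(0) g(t) >= f(0) G(t), impossible since F(0) < 0. *)
have /factor_theorem [g fg] : root f t by apply/eqP.
have /factor_theorem [G FG] : root F t by apply/eqP.
have Gt : 0 < G.[t].
  have := F'0 t (ltW t0).
  by rewrite FG derivM derivXsubC !hornerE subrr mulr0 add0r.
have gt : 0 <= g.[t].
  apply: (@poly_ge0_right g t (t + 1)); first by rewrite ltrDl.
  move=> x /andP[tx _]; have := ltW (fgt x tx).
  by rewrite fg !hornerE pmulr_lge0 // subr_gt0.
have F0 : F.[0] < 0 by have := deriv_pos_lt F'0 (lexx 0) t0; rewrite Ft.
have : 0 <= (F.[0] *: g - f.[0] *: G).[t].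
  apply: (poly_ge0_left t0) => x /[dup] /andP[x0' xt] /h_ge0.
  have fx : f.[x] = g.[x] * (x - t) by rewrite {1}fg !hornerE.
  have Fx : F.[x] = G.[x] * (x - t) by rewrite {1}FG !hornerE.
  rewrite /h !hornerE fx Fx.
  have -> : f.[0] * (G.[x] * (x - t)) - F.[0] * (g.[x] * (x - t)) =
    (F.[0] * g.[x] - f.[0] * G.[x]) * (t - x) by ring.
  by rewrite pmulr_lge0 // subr_gt0.
rewrite !hornerE; have := mulr_gt0 f0 Gt; have := mulr_le0_ge0 (ltW F0) gt; lra.
Qed.

End Calculus.
End Calculus.
Import Calculus.

(** * Determinantal pencils *)

Section DetPoly.

Definition detpoly (K : comNzRingType) n (X D : 'M[K]_n) : {poly K} :=
  \det (map_mx polyC X + 'X *: map_mx polyC D).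

Lemma horner_detpoly (K : comNzRingType) n (X D : 'M[K]_n) s :
  (detpoly X D).[s] = \det (X + s *: D).
Proof.
rewrite /detpoly -[LHS]/(horner_eval s _) -det_map_mx; congr (\det _).
apply/matrixP => i j; rewrite !mxE /= /horner_eval.
by rewrite hornerD hornerM hornerX !hornerC.
Qed.

Lemma map_detpoly (K L : comNzRingType) (f : {rmorphism K -> L}) n
    (X D : 'M[K]_n) :
  map_poly f (detpoly X D) = detpoly (map_mx f X) (map_mx f D).
Proof.
rewrite /detpoly -det_map_mx; congr (\det _).
by apply/matrixP => i j; rewrite !mxE rmorphD rmorphM /= !map_polyC map_polyX.
Qed.

Lemma detpoly_char_poly (K : fieldType) n (X D : 'M[K]_n) : D \in unitmx ->
  detpoly X D = \det D *: char_poly (- (invmx D *m X)).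
Proof.
move=> Du; rewrite -mul_polyC -det_map_mx /char_poly -det_mulmx; congr (\det _).
rewrite /char_poly_mx mulmxBr -scalemx1 -scalemxAr mulmx1 addrC; congr (_ + _).
by rewrite map_mxN mulmxN opprK -map_mxM mulKVmx.
Qed.

Lemma size_detpoly (K : fieldType) n (X D : 'M[K]_n) :
  D \in unitmx -> size (detpoly X D) = n.+1.
Proof.
move=> Du; rewrite detpoly_char_poly // size_scale ?size_char_poly //.
by rewrite -unitfE -unitmxE.
Qed.

Lemma lead_coef_detpoly (K : fieldType) n (X D : 'M[K]_n) :
  D \in unitmx -> lead_coef (detpoly X D) = \det D.
Proof.
move=> Du; rewrite detpoly_char_poly // lead_coefZ.
by rewrite (monicP (char_poly_monic _)) mulr1.
Qed.

(** Bordering [Y] turns the update into a determinant whose first row is affine in a; linearity in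
    that row gives the slope. *)
Lemma det_rank1 (K : comNzRingType) n (Y : 'M[K]_n) (v w : 'cV[K]_n) a :
  \det (Y + a *: (v *m w^T)) = \det Y + a * \det (block_mx 0 (- w^T) v Y).
Proof.
have e b : \det (Y + b *: (v *m w^T)) = \det (block_mx 1%:M (- b *: w^T) v Y).
  have -> : block_mx 1%:M (- b *: w^T) v Y =
      block_mx 1%:M 0 v 1%:M *m block_mx 1%:M (- b *: w^T) 0 (Y + b *: (v *m w^T)).
    rewrite mulmx_block !mul1mx !mul0mx ?mulmx0 !mulmx1 ?addr0 -scalemxAr.
    by rewrite !scaleNr [Y + _]addrC addKr.
  by rewrite det_mulmx det_lblock det_ublock !det1 !mul1r.
have e0 := e 0; rewrite oppr0 !scale0r addr0 in e0; rewrite e e0.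
rewrite (@determinant_multilinear _ _ (block_mx 1%:M (- a *: w^T) v Y)
  (block_mx 1%:M 0 v Y) (block_mx 0 (- w^T) v Y) ord0 1 a) ?mul1r //.
- apply/rowP => j; rewrite !mxE; case: splitP => [k _|k //].
  by rewrite !mxE; case: splitP => l _; rewrite !mxE; ring.
- by apply/matrixP => i j; rewrite !mxE; case: splitP => // k; rewrite [k]ord1.
- by apply/matrixP => i j; rewrite !mxE; case: splitP => // k; rewrite [k]ord1.
Qed.

(** One bordered matrix is factored into block triangular ones in two ways. *)
Lemma det_1_rank1 (K : comNzRingType) n (v w : 'cV[K]_n) :
  \det (1%:M + v *m w^T) = 1 + (w^T *m v) 0 0.
Proof.
have -> : \det (1%:M + v *m w^T) = \det (block_mx 1%:M (- w^T) v 1%:M).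
  have -> : block_mx 1%:M (- w^T) v 1%:M =
      block_mx 1%:M 0 v 1%:M *m block_mx 1%:M (- w^T) 0 (1%:M + v *m w^T).
    by rewrite mulmx_block !mul1mx !mul0mx !mulmx1 ?mulmx0 ?addr0 mulmxN addrCA addNr addr0.
  by rewrite det_mulmx det_lblock det_ublock !det1 !mul1r.
have -> : block_mx 1%:M (- w^T) v 1%:M =
    block_mx (1%:M + w^T *m v) (- w^T) 0 1%:M *m block_mx 1%:M 0 v 1%:M.
  by rewrite mulmx_block !mulmx1 !mul0mx !mulmx0 mul1mx !add0r mulNmx addrK.
by rewrite det_mulmx det_lblock det_ublock !det1 !mulr1 det_mx11 mxE [1%:M]mx11_scalar !mxE.
Qed.

Lemma det_rank1_affine (K : comNzRingType) n (Y : 'M[K]_n) (v : 'cV[K]_n) a :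
  \det (Y + a *: (v *m v^T)) =
  \det Y + a * (\det (Y + v *m v^T) - \det Y).
Proof.
have := det_rank1 Y v v 1; rewrite scale1r mul1r => ->.
by rewrite det_rank1; ring.
Qed.

Lemma detpoly_rank1_affine (K : comNzRingType) n (Y D : 'M[K]_n)
    (v : 'cV[K]_n) a :
  detpoly (Y + a *: (v *m v^T)) D =
  detpoly Y D + a *: (detpoly (Y + v *m v^T) D - detpoly Y D).
Proof.
rewrite -mul_polyC /detpoly.
have e b : map_mx polyC (Y + b *: (v *m v^T)) + 'X *: map_mx polyC D =
   (map_mx polyC Y + 'X *: map_mx polyC D) +
    b%:P *: (map_mx polyC v *m (map_mx polyC v)^T).
  by rewrite addrAC map_mxD map_mxZ map_mxM map_trmx.
have e1 := e 1; rewrite !scale1r in e1.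
by rewrite e det_rank1_affine -e1.
Qed.

End DetPoly.

(** * Stability in the upper half plane *)

Lemma mulmx_cartesian (K L : comNzRingType) (f : {rmorphism K -> L}) (i : L)
    p q r (a b : 'M[K]_(p, q)) (X Y : 'M[K]_(q, r)) : i * i = -1 ->
  (map_mx f a + i *: map_mx f b) *m (map_mx f X + i *: map_mx f Y) =
  map_mx f (a *m X - b *m Y) + i *: map_mx f (a *m Y + b *m X).
Proof.
move=> ii; rewrite mulmxDl !mulmxDr -!scalemxAl -!scalemxAr -!map_mxM scalerA ii.
rewrite map_mxB map_mxD scaleN1r scalerDr.
by rewrite [X in _ + X]addrC addrACA.
Qed.

Section Complex.
Variable R : realType.
Local Notation C := (complex R).
Local Notation toC := (real_complex R).
Local Notation Re := (@complex.Re R).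
Local Notation Im := (@complex.Im R).
Local Notation iC := (Complex (0 : R) 1).

Lemma ImD (x y : C) : Im (x + y) = Im x + Im y.
Proof. by case: x y => [a b] [c d] /=. Qed.

Lemma Im_inv_lt0 (z : C) : 0 < Im z -> Im z^-1 < 0.
Proof.
case: z => a b /= b0.
by rewrite oppr_lt0 divr_gt0 // ltr_wpDl ?sqr_ge0 // exprn_gt0.
Qed.

(** The logarithmic derivative is the sum of the 1/(s - r), each with negative imaginary part; the
    empty product has to be singled out. *)
Lemma Im_logderiv (rs : seq C) (s : C) : 0 < Im s ->
  (forall r, r \in rs -> Im r <= 0) ->
  let p := \prod_(r <- rs) ('X - r%:P) in
  p.[s] != 0 /\ (if rs is [::] then p^`().[s] = 0 else Im (p^`().[s] / p.[s]) < 0).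
Proof.
move=> s0; elim: rs => [|r rs IH] hrs /=.
  by rewrite big_nil hornerC oner_eq0 derivC horner0.
have [q0 hq] := IH (fun x hx => hrs x (mem_behead (s := r :: rs) hx)).
rewrite !big_cons; set q := \prod_(j <- rs) _ in q0 hq *.
have sr0 : 0 < Im (s - r).
  have := hrs r (mem_head _ _); move: s0.
  by case: (s) (r) => [a b] [c d] /=; lra.
have srn0 : s - r != 0 by apply: contraTneq sr0 => ->; rewrite ltxx.
rewrite !hornerE mulf_neq0 //; split=> //.
rewrite derivM derivXsubC !hornerE.
have -> : (q.[s] + (s - r) * q^`().[s]) / ((s - r) * q.[s]) =
  (s - r)^-1 + q^`().[s] / q.[s] by field; rewrite q0 srn0.
rewrite ImD; have := Im_inv_lt0 sr0.
case: (rs) hq => [->|? ? ?]; first by rewrite mul0r addr0.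
by lra.
Qed.

(** All roots lie in the closed lower half plane, so the logarithmic derivative has nonzero
    imaginary part in the open upper one. The size condition excludes constants. *)
Lemma gauss_lucas (p : {poly C}) :
  (forall s, 0 < Im s -> p.[s] != 0) -> (1 < size p)%N ->
  forall s, 0 < Im s -> p^`().[s] != 0.
Proof.
have [rs ->] := closed_field_poly_normal p.
set c := lead_coef p => hp szp s s0.
have cn0 : c != 0 by apply: contraTneq szp => ->; rewrite scale0r size_poly0.
have hrs r : r \in rs -> Im r <= 0.
  move=> rrs; rewrite leNgt; apply/negP => /hp; rewrite hornerZ mulf_eq0 negb_or.
  case/andP=> _; have : root (\prod_(z <- rs) ('X - z%:P)) r by rewrite root_prod_XsubC.
  by move=> /eqP ->; rewrite eqxx.
have /= [q0 q1] := Im_logderiv s0 hrs.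
rewrite derivZ hornerZ mulf_neq0 //.
case: rs szp {hp hrs} q0 q1 => [|r rs] szp q0 h.
  by move: szp; rewrite big_nil size_scale // size_poly1.
by apply/eqP => e; move: h; rewrite e mul0r ltxx.
Qed.

Lemma size_derivC (p : {poly C}) : size p^`() = (size p).-1.
Proof.
have [->|pn0] := eqVneq p 0; first by rewrite deriv0 size_poly0.
have [/size1_polyC ->|szp] := leqP (size p) 1.
  by rewrite derivC size_poly0 size_polyC; case: eqP.
have {szp} [n szp] : exists n, size p = n.+2 by case: (size p) szp => [|[|n]] // _; exists n.
have := size_poly (size p).-1 (fun i => p`_i.+1 *+ i.+1); rewrite -[\poly_(_ < _) _]/(p^`()) szp /=.
rewrite leq_eqVlt => /orP[/eqP //|]; rewrite ltnS => h.
have : p^`()`_n = 0 by apply: nth_default.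
move/eqP; rewrite coef_deriv mulrn_eq0 /= => /eqP pn.
by move: pn0; rewrite -lead_coef_eq0 lead_coefE szp pn eqxx.
Qed.

Lemma gauss_lucas_nderivn (p : {poly C}) k :
  (forall s, 0 < Im s -> p.[s] != 0) -> (k < size p)%N ->
  forall s, 0 < Im s -> p^`N(k).[s] != 0.
Proof.
move=> hp kp s s0.
have [_ H] : size p^`(k) = (size p - k)%N /\
    forall s, 0 < Im s -> p^`(k).[s] != 0.
  elim: k kp => [|k IH] kp; first by rewrite derivn0 subn0.
  have [sz h] := IH (ltnW kp); rewrite derivnS size_derivC sz -subnS; split=> //.
  by apply: gauss_lucas => //; rewrite sz ltn_subRL addn1.
move: (H s s0); rewrite nderivn_def hornerMn.
by apply: contraNneq => ->; rewrite mul0rn.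
Qed.

(** * Quadratic forms and nonvanishing of complex determinants *)

Definition qform n (Y : 'M[R]_n) (x : 'cV[R]_n) : R := (x^T *m Y *m x) 0 0.
(** Symmetry is kept as a separate hypothesis. *)
Definition posdef n (Y : 'M[R]_n) := forall x, x != 0 -> 0 < qform Y x.
Definition possemidef n (Y : 'M[R]_n) := forall x, 0 <= qform Y x.

Lemma qformD n (Y Z : 'M[R]_n) x : qform (Y + Z) x = qform Y x + qform Z x.
Proof. by rewrite /qform mulmxDr mulmxDl mxE. Qed.

Lemma qformZ n a (Y : 'M[R]_n) x : qform (a *: Y) x = a * qform Y x.
Proof. by rewrite /qform -scalemxAr -scalemxAl mxE. Qed.

Lemma qform_sum_sqr p (x : 'cV[R]_p) : (x^T *m x) 0 0 = \sum_i x i 0 ^+ 2.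
Proof. by rewrite mxE; apply: eq_bigr => i _; rewrite mxE expr2. Qed.

Lemma qform_rank1 n (v x : 'cV[R]_n) : qform (v *m v^T) x = (v^T *m x) 0 0 ^+ 2.
Proof.
rewrite /qform mulmxA -mulmxA mxE big_ord_recl big_ord0 addr0 expr2.
by congr (_ * _); rewrite -[x^T *m v]trmxK trmx_mul trmxK mxE.
Qed.

Lemma qform_gram n m (V : 'M[R]_(n, m)) x :
  qform (V *m V^T) x = \sum_i ((V^T *m x) i 0) ^+ 2.
Proof. by rewrite -qform_sum_sqr /qform trmx_mul trmxK !mulmxA. Qed.

(** A left kernel vector a + ib gives a H1 = b H2 and a H2 = - b H1. By symmetry the values of the
    form H2 at a and at b are then opposite, which forces a = b = 0. *)
Lemma det_complex_neq0 n (H1 H2 : 'M[R]_n) : H1^T = H1 -> H2^T = H2 ->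
  posdef H2 -> \det (map_mx toC H1 + iC *: map_mx toC H2) != 0.
Proof.
move=> s1 s2 pd2; apply/negP => /det0P [v vn0 hv].
pose a := map_mx Re v; pose b := map_mx Im v.
have vE : v = map_mx toC a + iC *: map_mx toC b.
  by apply/rowP => j; rewrite !mxE {1}(complexE (v 0 j)).
have hv' : (a *m H1 = b *m H2) /\ (a *m H2 = - (b *m H1)).
  have : map_mx toC (a *m H1 - b *m H2) + iC *: map_mx toC (a *m H2 + b *m H1) = 0.
    have ii : iC * iC = -1 by rewrite -expr2 sqr_i.
    by move: (hv); rewrite {1}vE (mulmx_cartesian _ _ _ _ _ ii).
  move=> /rowP h; split; apply/rowP => j; have := h j; rewrite !mxE => /eqP;
  by rewrite eq_complex /= => /andP[/eqP h1 /eqP h2]; lra.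
case: hv' => h1 h2.
have e1 : qform H2 a^T = - (b *m H1 *m a^T) 0 0.
  by rewrite /qform trmxK h2 mulNmx mxE.
have e2 : qform H2 b^T = (b *m H1 *m a^T) 0 0.
  rewrite /qform trmxK -h1.
  have -> : (a *m H1 *m b^T) 0 0 = ((a *m H1 *m b^T)^T) 0 0 by rewrite [RHS]mxE.
  by rewrite !trmx_mul trmxK s1 mulmxA.
have [a0|an0] := eqVneq a 0.
  have [b0|bn0] := eqVneq b 0.
    by move/negP: vn0; apply; rewrite vE a0 b0 !map_mx0 scaler0 addr0.
  have := pd2 b^T; rewrite trmx_eq0 bn0 e2 a0 trmx0 mulmx0 mxE ltxx.
  by move=> /(_ isT).
have p1 := pd2 a^T; rewrite trmx_eq0 in p1; have {p1} := p1 an0.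
have : 0 <= qform H2 b^T.
  have [->|bn0] := eqVneq b 0; first by rewrite /qform trmx0 mulmx0 mxE.
  by apply/ltW/pd2; rewrite trmx_eq0.
by rewrite e1 e2; lra.
Qed.

End Complex.

(** * The Rayleigh inequality *)

(** The derivative is divided by k!, so this is the coefficient of h^k in det(X + (s + h) D). *)
Definition dcoef (K : comNzRingType) n k (X D : 'M[K]_n) (s : K) : K :=
  (detpoly X D)^`N(k).[s].

Lemma dcoef_affine (K : comNzRingType) n k (X D : 'M[K]_n) (v : 'cV[K]_n) a s :
  dcoef k (X + a *: (v *m v^T)) D s =
  dcoef k X D s + a * (dcoef k (X + v *m v^T) D s - dcoef k X D s).
Proof.
rewrite /dcoef detpoly_rank1_affine nderivnD nderivnZ nderivnB.
by rewrite hornerD hornerZ hornerD hornerN.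
Qed.

Lemma map_dcoef (K L : comNzRingType) (f : {rmorphism K -> L}) n k
    (X D : 'M[K]_n) s :
  f (dcoef k X D s) = dcoef k (map_mx f X) (map_mx f D) (f s).
Proof. by rewrite /dcoef -map_detpoly nderivn_map horner_map. Qed.

Lemma add_divN_cancel (F : fieldType) (u w : F) : w != 0 -> u + - (u / w) * w = 0.
Proof. by move=> wn0; rewrite mulNr mulfVK // subrr. Qed.

Section Rayleigh.
Variable R : realType.
Local Notation C := (complex R).
Local Notation toC := (real_complex R).
Local Notation Re := (@complex.Re R).
Local Notation Im := (@complex.Im R).
Local Notation iC := (Complex (0 : R) 1).

Lemma posdef_unit n (D : 'M[R]_n) : posdef D -> D \in unitmx.
Proof.
move=> pd; rewrite unitmxE unitfE; apply/negP => /det0P [v vn0 hv].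
have := pd v^T; rewrite trmx_eq0 => /(_ vn0).
by rewrite /qform trmxK hv mul0mx mxE ltxx.
Qed.

Lemma cplx_lincomb (y p q d : R) (a b s : C) :
  toC y + a * toC p + b * toC q + s * toC d =
  toC (y + Re a * p + Re b * q + Re s * d) +
  iC * toC (Im a * p + Im b * q + Im s * d).
Proof.
case: a b s => [a1 a2] [b1 b2] [s1 s2]; apply/eqP; rewrite eq_complex /=.
by apply/andP; split; apply/eqP; ring.
Qed.

Lemma det_pencil_neq0 n (Y D P Q : 'M[R]_n) (a b s : C) :
  Y^T = Y -> D^T = D -> P^T = P -> Q^T = Q ->
  posdef D -> possemidef P -> possemidef Q ->
  0 < Im s -> 0 <= Im a -> 0 <= Im b ->
  \det (map_mx toC Y + a *: map_mx toC P + b *: map_mx toC Q +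
        s *: map_mx toC D) != 0.
Proof.
move=> sY sD sP sQ pdD pP pQ s0 a0 b0.
have -> : map_mx toC Y + a *: map_mx toC P + b *: map_mx toC Q + s *: map_mx toC D
  = map_mx toC (Y + Re a *: P + Re b *: Q + Re s *: D) +
    iC *: map_mx toC (Im a *: P + Im b *: Q + Im s *: D).
  by apply/matrixP => i j; rewrite !mxE; exact: cplx_lincomb.
apply: det_complex_neq0.
- by rewrite !linearD !linearZ /= sY sP sQ sD.
- by rewrite !linearD !linearZ /= sP sQ sD.
move=> x xn0; rewrite !qformD !qformZ.
by rewrite ltr_wpDl ?mulr_gt0 ?pdD // addr_ge0 // mulr_ge0.
Qed.

Lemma Im_horner (q : {poly C}) (x : R) :
  Im q.[toC x] = (\poly_(j < size q) Im q`_j).[x].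
Proof.
rewrite horner_coef horner_poly.
elim/big_ind2: _ => // [u u' w w' <- <-|j _]; first by rewrite ImD.
rewrite -rmorphXn /=; case: (q`_j) => c d /=.
by rewrite mulr0 add0r.
Qed.

(** On the vertical line above s both factors are polynomials in the height h, the second with
    conjugated coefficients, so continuity of a real polynomial at h = 0 applies. *)
Lemma Im_at0 (p q : {poly C}) (s : R) :
  (forall h, 0 < h -> 0 <= Im (p.[Complex s h] * conjc q.[Complex s h])) ->
  0 <= Im (p.[toC s] * conjc q.[toC s]).
Proof.
move=> H.
pose r := (p \Po ((toC s)%:P + iC *: 'X)) *
  ((map_poly (@conjc R) q) \Po ((toC s)%:P - iC *: 'X)).
have rE h : r.[toC h] = p.[Complex s h] * conjc q.[Complex s h].
  rewrite hornerM !horner_comp !hornerD !hornerN !hornerZ hornerC hornerX.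
  have e1 : toC s + iC * toC h = Complex s h.
    by apply/eqP; rewrite eq_complex /=; apply/andP; split; apply/eqP; ring.
  have e2 : toC s - iC * toC h = conjc (Complex s h).
    by apply/eqP; rewrite eq_complex /=; apply/andP; split; apply/eqP; ring.
  by rewrite e1 e2 horner_map.
have := rE 0; rewrite -[Complex s 0]/(toC s) => <-; rewrite Im_horner.
by apply: poly_ge0_at0 => h h0; rewrite -Im_horner rE; exact: H.
Qed.

Lemma Im_neg_div (u w : C) : Im (u * conjc w) < 0 -> w != 0 /\ 0 < Im (- (u / w)).
Proof.
case: u w => [a b] [c d] /= h.
have n0 : 0 < c ^+ 2 + d ^+ 2.
  rewrite lt_neqAle addr_ge0 ?sqr_ge0 // andbT eq_sym paddr_eq0 ?sqr_ge0 //.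
  rewrite !sqrf_eq0; apply/negP => /andP[/eqP c0 /eqP d0].
  by move: h; rewrite c0 d0 oppr0 !mulr0 addr0 ltxx.
split.
  rewrite eq_complex /=; apply/negP => /andP[/eqP c0 /eqP d0].
  by move: n0; rewrite c0 d0 expr0n /= addr0 ltxx.
rewrite oppr_gt0.
have -> : a * - (d / (c ^+ 2 + d ^+ 2)) + b * (c / (c ^+ 2 + d ^+ 2)) =
  (a * - d + b * c) / (c ^+ 2 + d ^+ 2) by ring.
by rewrite pmulr_llt0 // invr_gt0.
Qed.

Lemma possemidef_rank1 n (v : 'cV[R]_n) : possemidef (v *m v^T).
Proof. by move=> x; rewrite qform_rank1 sqr_ge0. Qed.

Lemma trmx_rank1 n (v : 'cV[R]_n) : (v *m v^T)^T = v *m v^T.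
Proof. by rewrite trmx_mul trmxK. Qed.

(** With complex weights a, b on the two directions the coefficient is affine in a and in b, and by
    Gauss-Lucas it does not vanish at z in the open upper half plane when a, b lie in the closed
    one. The inequality is the trace of this nonvanishing for a = i as z tends to the real point
    s. *)
Lemma rayleigh_posdef n (Y D : 'M[R]_n) (v w : 'cV[R]_n) k s :
  Y^T = Y -> D^T = D -> posdef D ->
  dcoef k Y D s * dcoef k (Y + v *m v^T + w *m w^T) D s <=
  dcoef k (Y + v *m v^T) D s * dcoef k (Y + w *m w^T) D s.
Proof.
move=> sY sD pdD; have Du := posdef_unit pdD.
have [nk|kn] := ltnP n k.
  by rewrite /dcoef !nderivn_poly0 ?size_detpoly // horner0 mul0r.
pose cv := map_mx toC v; pose cw := map_mx toC w.
pose X a b := map_mx toC Y + a *: (cv *m cv^T) + b *: (cw *m cw^T).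
have XE a b : X a b = map_mx toC Y + a *: map_mx toC (v *m v^T) + b *: map_mx toC (w *m w^T).
  by rewrite /X !map_mxM !map_trmx.
have cDu : map_mx toC D \in unitmx by rewrite map_unitmx.
have nz a b z : 0 < Im z -> 0 <= Im a -> 0 <= Im b ->
    dcoef k (X a b) (map_mx toC D) z != 0.
  move=> z0 a0 b0; apply: gauss_lucas_nderivn => //; last by rewrite size_detpoly.
  move=> y y0; rewrite horner_detpoly XE.
  by apply: det_pencil_neq0 => //; rewrite ?trmx_rank1 //; exact: possemidef_rank1.
have Xb a b z : dcoef k (X a b) (map_mx toC D) z =
   dcoef k (X a 0) (map_mx toC D) z +
   b * (dcoef k (X a 1) (map_mx toC D) z - dcoef k (X a 0) (map_mx toC D) z).
  by rewrite {1}/X dcoef_affine /X scale0r addr0 scale1r.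
pose dX b z := dcoef k (X iC b) (map_mx toC D) z.
pose pu := (detpoly (X iC 0) (map_mx toC D))^`N(k).
pose pw := (detpoly (X iC 1) (map_mx toC D))^`N(k) - pu.
have pwE z : pw.[z] = dX 1 z - dX 0 z by rewrite /pw hornerD hornerN.
(* A negative imaginary part at some z would put the zero in b of the affine function b -> dX b z
   into the upper half plane, which [nz] forbids. *)
have key : 0 <= Im (dX 0 (toC s) * conjc (dX 1 (toC s) - dX 0 (toC s))).
  rewrite -pwE; apply: (@Im_at0 pu pw s) => h h0; rewrite pwE.
  rewrite -[pu.[_]]/(dX 0 (Complex s h)).
  move: (Complex s h) (h0 : 0 < Im (Complex s h)) => z z0; rewrite leNgt; apply/negP.
  move=> /Im_neg_div [wn0 b0].
  move/negP: (nz iC _ z z0 ler01 (ltW b0)); apply; apply/eqP.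
  exact: etrans (Xb _ _ _) (add_divN_cancel (dX 0 z) wn0).
have v1 M : map_mx toC M + cv *m cv^T = map_mx toC (M + v *m v^T).
  by rewrite map_mxD map_mxM map_trmx.
have w1 M : map_mx toC M + cw *m cw^T = map_mx toC (M + w *m w^T).
  by rewrite map_mxD map_mxM map_trmx.
have d0E : dX 0 (toC s) = toC (dcoef k Y D s) +
    iC * toC (dcoef k (Y + v *m v^T) D s - dcoef k Y D s).
  rewrite /dX /X scale0r addr0 dcoef_affine v1 -!map_dcoef.
  by rewrite [toC (_ - _)]rmorphB.
have d1E : dX 1 (toC s) = toC (dcoef k (Y + w *m w^T) D s) +
    iC * toC (dcoef k (Y + v *m v^T + w *m w^T) D s - dcoef k (Y + w *m w^T) D s).
  rewrite /dX /X scale1r addrAC w1 dcoef_affine v1 [Y + w *m _ + _]addrAC.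
  by rewrite -!map_dcoef [toC (_ - _)]rmorphB.
(* At the real point s the imaginary part equals [x10 * x01 - x00 * x11]. *)
move: key; rewrite d0E d1E /=.
set x00 := dcoef k Y D s; set x10 := dcoef k (Y + v *m v^T) D s.
set x01 := dcoef k (Y + w *m w^T) D s.
set x11 := dcoef k (Y + v *m v^T + w *m w^T) D s.
by nra.
Qed.

End Rayleigh.

(** * Normalised derivatives of polynomials *)

Section NDeriv.
Variable K : nzRingType.
Implicit Type p : {poly K}.

Lemma deriv_nderivn p j : (p^`N(j))^`() = p^`N(j.+1) *+ j.+1.
Proof.
apply/polyP => i; rewrite coef_deriv coefMn !coef_nderivn -!mulrnA.
rewrite addnS addSn; congr (_ *+ _).
by rewrite mulnC [RHS]mulnC mul_bin_left subSn ?leq_addr // addKn.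
Qed.

Lemma nderivn_deriv p j : (p^`())^`N(j) = (p^`N(j))^`().
Proof.
apply/polyP => i; rewrite coef_deriv !coef_nderivn coef_deriv -!mulrnA.
rewrite -addnS; congr (_ *+ _).
by rewrite addnS mul_bin_down subSn ?leq_addr // addKn mulnC.
Qed.

Lemma nderivn_sum I (r : seq I) (P : pred I) (F : I -> {poly K}) j :
  (\sum_(i <- r | P i) F i)^`N(j) = \sum_(i <- r | P i) (F i)^`N(j).
Proof.
apply: (big_morph (fun p => p^`N(j)) (fun p q => nderivnD j p q)).
by rewrite nderivn_poly0 ?size_poly0.
Qed.

End NDeriv.

(** * Shifts, linear coefficients and compressions of pencils *)

Section DetPolyTheory.
Variable K : comNzRingType.

Lemma detpoly_shift n (X D : 'M[K]_n) s :
  detpoly (X + s *: D) D = detpoly X D \Po ('X + s%:P).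
Proof.
rewrite /detpoly -[RHS]/(comp_poly _ _) -det_map_mx; congr (\det _).
apply/matrixP => i j; rewrite !mxE /= comp_polyD comp_polyM comp_polyX !comp_polyC.
by rewrite polyCD polyCM mulrDl addrAC addrA.
Qed.

(** Taylor's formula moves the expansion point into [X]. *)
Lemma dcoefE n k (X D : 'M[K]_n) s : dcoef k X D s = (detpoly (X + s *: D) D)`_k.
Proof.
rewrite detpoly_shift /dcoef; set p := detpoly X D.
have -> : p \Po ('X + s%:P) = \sum_(i < size p) p^`N(i).[s] *: 'X^i.
  rewrite /comp_poly addrC nderiv_taylor; last exact: mulrC.
  rewrite (size_map_inj_poly (@polyC_inj _)) //; apply: eq_bigr => i _.
  by rewrite nderivn_map horner_map mul_polyC.
rewrite coef_sum; have [kp|pk] := ltnP k (size p); last first.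
  rewrite nderivn_poly0 // horner0 big1 // => i _.
  by rewrite coefZ coefXn gtn_eqF ?mulr0 // (leq_trans (ltn_ord i)).
rewrite (bigD1 (Ordinal kp)) //= coefZ coefXn eqxx mulr1 big1 ?addr0 // => i ik.
by rewrite coefZ coefXn eq_sym -val_eqE /= in ik *; rewrite (negPf ik) mulr0.
Qed.

(** Each rank-one term enters the determinant affinely, so interactions between two terms only reach
    higher powers of the variable. *)
Lemma coef1_detpoly_sum n I (r : seq I) (v : I -> 'cV[K]_n) (Y : 'M[K]_n) :
  (detpoly Y (\sum_(i <- r) v i *m (v i)^T))`_1 =
  \sum_(i <- r) (\det (Y + v i *m (v i)^T) - \det Y).
Proof.
elim: r => [|i r IH].
  by rewrite !big_nil /detpoly map_mx0 scaler0 addr0 det_map_mx coefC.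
rewrite !big_cons -IH; set E := \sum_(j <- r) _.
have e M : (detpoly M E)`_0 = \det M.
  by rewrite -horner_coef0 horner_detpoly scale0r addr0.
have eD : detpoly Y (v i *m (v i)^T + E) =
    detpoly Y E + 'X * (detpoly (Y + v i *m (v i)^T) E - detpoly Y E).
  rewrite /detpoly !map_mxD scalerDr [X in _ + X]addrC addrA map_mxM -map_trmx.
  by rewrite det_rank1_affine addrAC.
by rewrite eD coefD coefXM /= coefB !e addrC.
Qed.

Lemma mul_rankone_sum n N (V : 'M[K]_(n, N)) :
  V *m V^T = \sum_i col i V *m (col i V)^T.
Proof.
apply/matrixP => i j; rewrite mxE summxE; apply: eq_bigr => l _.
by rewrite !mxE big_ord_recl big_ord0 addr0 !mxE.
Qed.

(** After the basis change [G] the vector v is the first unit vector, so the update touches one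
    diagonal entry and the increment is the complementary minor of [G *m Y *m G^T]. *)
Lemma det_compress n (G : 'M[K]_(1 + n)) (v : 'cV[K]_(1 + n)) (Y : 'M[K]_(1 + n)) :
  G *m v = col_mx 1%:M 0 ->
  (\det G) ^+ 2 * (\det (Y + v *m v^T) - \det Y) =
  \det (dsubmx G *m Y *m (dsubmx G)^T).
Proof.
move=> Gv; pose Z := G *m Y *m G^T.
have e M : (\det G) ^+ 2 * \det M = \det (G *m M *m G^T).
  by rewrite !det_mulmx det_tr expr2 mulrAC.
rewrite mulrBr !e mulmxDr mulmxDl -/Z.
have -> : G *m (v *m v^T) *m G^T = block_mx 1%:M 0 0 0.
  rewrite mulmxA Gv -mulmxA -trmx_mul Gv tr_col_mx mul_col_row trmx0 trmx1.
  by rewrite mul1mx mulmx0 !mul0mx.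
have -> : dsubmx G *m Y *m (dsubmx G)^T = drsubmx Z.
  rewrite /Z -[G in RHS]vsubmxK mul_col_mx tr_col_mx mul_col_row.
  by rewrite block_mxKdr.
rewrite -{1 2}[Z]submxK add_block_mx !addr0.
set a := ulsubmx Z; set b := ursubmx Z; set c := dlsubmx Z; set d := drsubmx Z.
rewrite (@determinant_multilinear _ _ (block_mx (a + 1%:M) b c d)
  (block_mx a b c d) (block_mx 1%:M 0 c d) ord0 1 1) ?mul1r.
- by rewrite addrC addKr det_lblock det1 mul1r.
- apply/rowP => j; rewrite !mxE; case: splitP => [k _|k //].
  by rewrite !mxE; case: splitP => l _; rewrite !mxE; ring.
- by apply/matrixP => i j; rewrite !mxE; case: splitP => // k; rewrite [k]ord1.
- by apply/matrixP => i j; rewrite !mxE; case: splitP => // k; rewrite [k]ord1.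
Qed.

End DetPolyTheory.

Lemma detpoly_compress (K : comNzRingType) n (G : 'M[K]_(1 + n))
    (v : 'cV[K]_(1 + n)) (X D : 'M[K]_(1 + n)) :
  G *m v = col_mx 1%:M 0 ->
  (\det G) ^+ 2 *: (detpoly (X + v *m v^T) D - detpoly X D) =
  detpoly (dsubmx G *m X *m (dsubmx G)^T) (dsubmx G *m D *m (dsubmx G)^T).
Proof.
move=> Gv; rewrite -mul_polyC.
have Gv' : map_mx polyC G *m map_mx polyC v = col_mx 1%:M 0.
  by rewrite -map_mxM Gv map_col_mx map_mx1 map_mx0.
have := det_compress (map_mx polyC X + 'X *: map_mx polyC D) Gv'.
rewrite det_map_mx -polyC_exp /detpoly map_mxD map_mxM -map_trmx addrAC => ->.
congr (\det _); rewrite -map_dsubmx map_trmx mulmxDr mulmxDl -scalemxAr -scalemxAl.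
by rewrite !map_mxM.
Qed.

Lemma exists_basis_change (F : fieldType) n (v : 'cV[F]_(1 + n)) : v != 0 ->
  exists2 G : 'M[F]_(1 + n), G \in unitmx & G *m v = col_mx 1%:M 0.
Proof.
move=> vn0.
have rv : \rank v = 1%N.
  by apply/eqP; rewrite eqn_leq rank_leq_col lt0n mxrank_eq0.
pose c := row_ebase v 0 0.
have cn0 : c != 0.
  by have := row_ebase_unit v; rewrite unitmxE det_mx11 unitfE.
exists (c^-1 *: invmx (col_ebase v)).
  by rewrite unitmxZ ?unitmx_inv ?col_ebase_unit // unitfE invr_eq0.
rewrite -{2}(mulmx_ebase v) rv -scalemxAl -!mulmxA mulKmx ?col_ebase_unit //.
have -> : row_ebase v = c%:M by rewrite [LHS]mx11_scalar.
rewrite mul_mx_scalar scalerA mulVf // scale1r.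
apply/matrixP => i j; rewrite !mxE; case: splitP => l il; rewrite !mxE il.
  by rewrite [l]ord1 [j]ord1.
  by rewrite [j]ord1.
Qed.

(** * Selection of columns *)

Section Selection.
Variable R : realType.

Lemma sqr_sum_gt0 n (x : 'cV[R]_n) : x != 0 -> 0 < \sum_i x i 0 ^+ 2.
Proof.
move=> xn0; rewrite lt_neqAle sumr_ge0 ?andbT => [|i _]; last exact: sqr_ge0.
apply: contra xn0; rewrite eq_sym psumr_eq0 => [/allP h|i _]; last exact: sqr_ge0.
apply/eqP/matrixP => i j; rewrite [j]ord1 mxE.
by apply/eqP; rewrite -sqrf_eq0; apply: h; rewrite mem_index_enum.
Qed.

Lemma qform1 n (x : 'cV[R]_n) : qform 1%:M x = \sum_i x i 0 ^+ 2.
Proof. by rewrite /qform mulmx1 qform_sum_sqr. Qed.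

(** The positive definite case applies to D + h I for h > 0; both sides are polynomials in h, so
    continuity gives h = 0. *)
Lemma rayleigh n (Y D : 'M[R]_n) (v w : 'cV[R]_n) k s :
  Y^T = Y -> D^T = D -> possemidef D ->
  dcoef k Y D s * dcoef k (Y + v *m v^T + w *m w^T) D s <=
  dcoef k (Y + v *m v^T) D s * dcoef k (Y + w *m w^T) D s.
Proof.
move=> sY sD psd.
pose D' : 'M[{poly R}]_n := map_mx polyC D + 'X *: 1%:M.
have D'E h : map_mx (horner_eval h) D' = D + h *: 1%:M.
  apply/matrixP => i j; rewrite !mxE /= /horner_eval.
  by rewrite hornerD hornerM hornerX hornerC; case: (i == j); rewrite !hornerE.
have mE M h : map_mx (horner_eval h) (map_mx polyC M) = M :> 'M[R]_n.
  by apply/matrixP => i j; rewrite !mxE /= /horner_eval hornerC.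
have [d dE] : exists d : 'M[R]_n -> {poly R},
    forall M h, (d M).[h] = dcoef k M (D + h *: 1%:M) s.
  exists (fun M => dcoef k (map_mx polyC M) D' s%:P) => M h.
  by rewrite -[LHS]/(horner_eval h _) map_dcoef mE D'E /= /horner_eval hornerC.
pose q := d (Y + v *m v^T) * d (Y + w *m w^T) - d Y * d (Y + v *m v^T + w *m w^T).
have qE h : q.[h] = (d (Y + v *m v^T)).[h] * (d (Y + w *m w^T)).[h] -
    (d Y).[h] * (d (Y + v *m v^T + w *m w^T)).[h].
  by rewrite hornerD hornerN !hornerM.
have : 0 <= q.[0]; last by rewrite qE !dE scale0r addr0 subr_ge0.
apply: poly_ge0_at0 => h h0; rewrite qE !dE subr_ge0; apply: rayleigh_posdef => //.
  by rewrite linearD linearZ /= trmx1 sD.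
move=> x xn0; rewrite qformD qformZ qform1.
by rewrite ltr_wpDl // mulr_gt0 // sqr_sum_gt0.
Qed.

(** At each s the derivative is the linear coefficient of the pencil based at X + s D. *)
Lemma detpoly_deriv n N (X : 'M[R]_n) (V : 'M[R]_(n, N)) :
  let D := V *m V^T in
  (detpoly X D)^`() =
  \sum_i (detpoly (X + col i V *m (col i V)^T) D - detpoly X D).
Proof.
move=> D; apply/eqP; rewrite -subr_eq0; apply/eqP.
apply: (@poly_eq0_on_itv _ _ 0 1) => // s _.
have -> : (detpoly X D)^`() = (detpoly X D)^`N(0)^`() by rewrite nderivn0.
rewrite hornerD hornerN deriv_nderivn mulr1n -[_.[s]]/(dcoef 1 X D s) dcoefE.
rewrite {2}/D mul_rankone_sum coef1_detpoly_sum horner_sum -sumrB big1 // => i _.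
by rewrite hornerD hornerN !horner_detpoly [X + _ + _]addrAC subrr.
Qed.

Lemma deriv_dcoef n N j (X : 'M[R]_n) (V : 'M[R]_(n, N)) s :
  ((detpoly X (V *m V^T))^`N(j))^`().[s] =
  \sum_i (dcoef j (X + col i V *m (col i V)^T) (V *m V^T) s -
          dcoef j X (V *m V^T) s).
Proof.
rewrite -nderivn_deriv detpoly_deriv nderivn_sum horner_sum.
by apply: eq_bigr => i _; rewrite nderivnB hornerD hornerN.
Qed.

(** * The Wronskian of a pencil coefficient and its rank-one increment *)

Section Wronskian.
Variables (n N j : nat) (X : 'M[R]_n) (V : 'M[R]_(n, N)) (v : 'cV[R]_n).
Hypothesis sX : X^T = X.
Let D := V *m V^T.
Let F := (detpoly X D)^`N(j).
Let f := (detpoly (X + v *m v^T) D - detpoly X D)^`N(j).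

(** Expanding the derivatives over the columns w of [V], the term of w becomes q_v q_w - q q_vw,
    nonnegative by the Rayleigh inequality. *)
Lemma wronskian_ge0 s : 0 <= f.[s] * F^`().[s] - f^`().[s] * F.[s].
Proof.
have sD : D^T = D by rewrite trmx_mul trmxK.
have pD : possemidef D.
  by move=> x; rewrite qform_gram sumr_ge0 // => i _; exact: sqr_ge0.
have fE : f.[s] = dcoef j (X + v *m v^T) D s - dcoef j X D s.
  by rewrite /f nderivnB hornerD hornerN.
have f'E : f^`().[s] = \sum_i
    ((dcoef j (X + v *m v^T + col i V *m (col i V)^T) D s - dcoef j (X + v *m v^T) D s) -
     (dcoef j (X + col i V *m (col i V)^T) D s - dcoef j X D s)).
  by rewrite /f nderivnB derivB hornerD hornerN !deriv_dcoef -sumrB.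
rewrite fE f'E deriv_dcoef -[F.[s]]/(dcoef j X D s) mulr_sumr mulr_suml -sumrB.
apply: sumr_ge0 => i _; have := rayleigh v (col i V) j s sX sD pD.
rewrite -/D; set a := dcoef _ _ _ _; set b := dcoef _ _ _ _.
set c := dcoef _ _ _ _; set d := dcoef _ _ _ _.
by nra.
Qed.

End Wronskian.

Lemma nderivn_lead n j (p : {poly R}) : size p = n.+1 -> (j <= n)%N ->
  0 < lead_coef p ->
  size p^`N(j) = (n - j).+1 /\ 0 < lead_coef p^`N(j).
Proof.
move=> szp jn lp.
have c : 0 < (p^`N(j))`_(n - j).
  rewrite coef_nderivn subnKC // pmulrn_lgt0; first by rewrite lead_coefE szp in lp.
  by rewrite bin_gt0.
have sz : size p^`N(j) = (n - j).+1.
  apply/eqP; rewrite eqn_leq; apply/andP; split.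
    by apply: leq_trans (size_poly _ _) _; rewrite szp subSn.
  by rewrite ltnNge; apply/negP => /leq_sizeP /(_ _ (leqnn _)) h; rewrite h ltxx in c.
by rewrite lead_coefE sz.
Qed.

(** The segment from the identity to D consists of positive definite, hence invertible matrices, so
    the determinant keeps the sign it has at the identity. *)
Lemma posdef_det_gt0 n (D : 'M[R]_n) : posdef D -> 0 < \det D.
Proof.
move=> pd; rewrite ltNge; apply/negP => dD.
pose p := detpoly 1%:M (D - 1%:M).
have p0 : p.[0] = 1 by rewrite horner_detpoly scale0r addr0 det1.
have p1 : p.[1] = \det D by rewrite horner_detpoly scale1r addrC subrK.
have [|s] := @polyrcf.poly_ivt _ p 0 1 ler01; first by rewrite p0 p1 mul1r.
rewrite in_itv /= => /andP[s0 s1]; rewrite /root horner_detpoly.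
suff /posdef_unit : posdef (1%:M + s *: (D - 1%:M)) by rewrite unitmxE unitfE => /negPf ->.
move=> x xn0; have -> : 1%:M + s *: (D - 1%:M) = (1 - s) *: 1%:M + s *: D.
  by rewrite scalerBr scalerBl scale1r addrAC addrA.
rewrite qformD !qformZ qform1.
have := sqr_sum_gt0 xn0; have := pd x xn0; set a := qform _ _; set b := \sum_i _.
by move=> a0 b0; nra.
Qed.

Lemma qform_congr n p (H : 'M[R]_(p, n)) (D : 'M[R]_n) x :
  qform (H *m D *m H^T) x = qform D (H^T *m x).
Proof. by rewrite /qform trmx_mul trmxK !mulmxA. Qed.

(** The rows of [H] are the last n rows of a basis change [G] sending v to the first unit vector, so
    they span the complement of v; the constant is the inverse square of det G. *)
Lemma compression n (D : 'M[R]_(1 + n)) (v : 'cV[R]_(1 + n)) : v != 0 -> posdef D ->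
  exists (H : 'M[R]_(n, 1 + n)) (c : R), [/\ 0 < c,
    forall X, detpoly (X + v *m v^T) D - detpoly X D =
      c *: detpoly (H *m X *m H^T) (H *m D *m H^T),
    posdef (H *m D *m H^T), H *m v = 0 &
    forall u : 'cV[R]_(1 + n), (u^T *m v) 0 0 = 0 -> exists u', u = H^T *m u'].
Proof.
move=> vn0 pd; have [G Gu Gv] := exists_basis_change vn0.
have dG : \det G != 0 by rewrite -unitfE -unitmxE.
exists (dsubmx G), ((\det G) ^- 2).
have GT u' : G^T *m col_mx 0 u' = (dsubmx G)^T *m u'.
  by rewrite -{1}[G]vsubmxK tr_col_mx mul_row_col mulmx0 add0r.
split.
- by rewrite invr_gt0 lt_neqAle sqr_ge0 andbT eq_sym sqrf_eq0.
- by move=> X; rewrite -(detpoly_compress _ _ Gv) scalerA mulVf ?scale1r // sqrf_eq0.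
- move=> x xn0; rewrite qform_congr; apply: pd.
  rewrite -GT; apply: contra xn0 => /eqP h.
  have : col_mx 0 x = 0 :> 'cV_(1 + n).
    by rewrite -[LHS](mulKmx (_ : G^T \in unitmx)) ?unitmx_tr // h mulmx0.
  by rewrite -[RHS](col_mx0 _) => /eq_col_mx [_ ->].
- by rewrite mul_dsub_mx Gv col_mxKd.
- move=> u uv; pose a := invmx G^T *m u.
  have ua : u = G^T *m a by rewrite mulKVmx // unitmx_tr.
  exists (dsubmx a); rewrite -GT ua; congr (_ *m _); rewrite -[LHS]vsubmxK.
  congr (col_mx _ _); apply/matrixP => p l; rewrite [p]ord1 [l]ord1 [RHS]mxE -uv.
  rewrite ua trmx_mul trmxK -mulmxA Gv -{2}[a]vsubmxK tr_col_mx mul_row_col mulmx0.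
  by rewrite addr0 mulmx1 [RHS]mxE.
Qed.

(** For u nonzero and v = X u, the increment of det X along v is det X times the value of the form
    at u. The Wronskian argument for the pencil and its increment along v makes it positive. *)
Lemma posdef_of_det_pencil n N (X : 'M[R]_n) (V : 'M[R]_(n, N)) :
  X^T = X -> posdef (V *m V^T) ->
  (forall s, 0 <= s -> 0 < \det (X + s *: (V *m V^T))) -> posdef X.
Proof.
case: n X V => [|n] X V sX pd hs u un0.
  by move/eqP: un0; case; apply/matrixP => -[].
have Du := posdef_unit pd.
have dX : 0 < \det X by have := hs 0 (lexx _); rewrite scale0r addr0.
have Xu : X \in unitmx by rewrite unitmxE unitfE gt_eqF.
pose v := X *m u.
have vn0 : v != 0.
  by apply: contra un0 => /eqP h; rewrite -[u](mulKmx Xu) -/v h mulmx0.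
have [H [c [c0 hc pdH _ _]]] := @compression n _ _ vn0 pd.
have szF := size_detpoly X Du.
pose f := detpoly (X + v *m v^T) (V *m V^T) - detpoly X (V *m V^T).
have fE : f = c *: detpoly (H *m X *m H^T) (H *m (V *m V^T) *m H^T) by exact: hc.
have szf : size f = n.+1.
  by rewrite fE size_scale ?gt_eqF // size_detpoly // posdef_unit.
have : 0 < f.[0].
  apply: (@wronskian_pos _ f (detpoly X (V *m V^T)) 0) => //.
  - by move=> x /hs; rewrite horner_detpoly.
  - move=> x; have := wronskian_ge0 0 V v sX x.
    by rewrite !nderivn0.
  - by rewrite szF szf.
  - by rewrite lead_coef_detpoly // posdef_det_gt0.
  - by rewrite -size_poly_gt0 szf.
rewrite /f hornerD hornerN !horner_detpoly scale0r !addr0.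
have -> : X + v *m v^T = X *m (1%:M + u *m v^T) by rewrite mulmxDr mulmx1 mulmxA.
rewrite det_mulmx det_1_rank1 mulrDr mulr1 addrC addKr pmulr_rgt0 //.
by rewrite /v trmx_mul sX.
Qed.

(** Coefficient vectors keep the full index set and vanish off S, so passing from V to a compression
    [H *m V] involves no reindexing. *)
Definition indep_cols n N (V : 'M[R]_(n, N)) (S : {set 'I_N}) :=
  forall c : 'cV[R]_N, (forall i, i \notin S -> c i 0 = 0) -> V *m c = 0 -> c = 0.

Lemma mulmx_col_delta n N (V : 'M[R]_(n, N)) i : V *m delta_mx i 0 = col i V.
Proof. by rewrite colE. Qed.

(** Induction on k. Coefficient k + 1 is, up to a positive factor, the derivative of coefficient k,
    which is the sum of the increments [f i] along the columns. One increment is positive at 0,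
    remains positive, and is a positive multiple of coefficient k of the pencil compressed to the
    complement of its column. *)
Theorem selection k n N (X : 'M[R]_n) (V : 'M[R]_(n, N)) :
  X^T = X -> posdef (V *m V^T) ->
  (forall s, 0 <= s -> 0 < dcoef k X (V *m V^T) s) ->
  exists S : {set 'I_N}, [/\ #|S| = k, indep_cols V S &
    forall u : 'cV[R]_n, (forall i, i \in S -> (u^T *m col i V) 0 0 = 0) ->
      u != 0 -> 0 < qform X u].
Proof.
elim: k n X V => [|k IH] n X V sX pd hs.
  exists set0; split; first by rewrite cards0.
    by move=> c hc _; apply/matrixP => i j; rewrite [j]ord1 mxE hc ?inE.
  move=> u _; apply: (posdef_of_det_pencil sX pd) => s /hs.
  by rewrite /dcoef nderivn0 horner_detpoly.
have Du := posdef_unit pd.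
have kn : (k < n)%N.
  rewrite ltnNge; apply/negP => nk; have := hs 0 (lexx _).
  by rewrite /dcoef nderivn_poly0 ?size_detpoly // horner0 ltxx.
case: n X V sX pd hs Du kn => // n X V sX pd hs Du kn.
set D := V *m V^T in pd hs Du *.
pose F := (detpoly X D)^`N(k).
pose f i := (detpoly (X + col i V *m (col i V)^T) D - detpoly X D)^`N(k).
have F'E : F^`() = (detpoly X D)^`N(k.+1) *+ k.+1 by rewrite deriv_nderivn.
have F'0 s : 0 <= s -> 0 < F^`().[s].
  by move=> /hs h; rewrite F'E hornerMn pmulrn_rgt0.
have Fsum : F^`() = \sum_i f i.
  by rewrite /F -nderivn_deriv detpoly_deriv nderivn_sum.
have [i fi0] : exists i, 0 < (f i).[0].
  apply: contrapT => h; have := F'0 0 (lexx _); rewrite ltNge; apply/negP/negPn.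
  rewrite Fsum horner_sum; apply: sumr_le0 => i _; rewrite leNgt; apply/negP => fi.
  by apply: h; exists i.
pose v := col i V.
have vn0 : v != 0.
  apply/negP => /eqP v0; move: fi0; rewrite /f -/v v0 mul0mx addr0 subrr.
  by rewrite nderivn_poly0 ?size_poly0 // horner0 ltxx.
have [H [c [c0 hc pdH Hv Hu]]] := @compression n _ _ vn0 pd.
have fE : f i = c *: (detpoly (H *m X *m H^T) (H *m D *m H^T))^`N(k).
  by rewrite /f -/v hc nderivnZ.
have D'E : H *m D *m H^T = (H *m V) *m (H *m V)^T by rewrite trmx_mul !mulmxA.
have [szF lF] : size F = (n.+1 - k).+1 /\ 0 < lead_coef F.
  apply: nderivn_lead; first exact: size_detpoly.
    exact: ltnW.
  by rewrite lead_coef_detpoly // posdef_det_gt0.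
have DHu := posdef_unit pdH.
have [szf _] : size (detpoly (H *m X *m H^T) (H *m D *m H^T))^`N(k) = (n - k).+1 /\
    0 < lead_coef (detpoly (H *m X *m H^T) (H *m D *m H^T))^`N(k).
  apply: nderivn_lead; [exact: size_detpoly | by [] |].
  by rewrite lead_coef_detpoly // posdef_det_gt0.
(* [F] may be negative at 0; only its derivative is known to be positive. *)
have fpos s : 0 <= s -> 0 < (f i).[s].
  move=> s0; apply: (@wronskian_pos_from0 _ (f i) F) => //.
  - by move=> x; apply: wronskian_ge0.
  - by rewrite szF fE size_scale ?gt_eqF // szf subSn.
have [||s s0|S [cS iS qS]] := IH n (H *m X *m H^T) (H *m V).
- by rewrite !trmx_mul trmxK sX mulmxA.
- by rewrite -D'E.
- by have := fpos s s0; rewrite fE hornerZ pmulr_rgt0 // -D'E.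
(* Column i of [H *m V] is zero and so belongs to no independent set. *)
have iNS : i \notin S.
  apply/negP => iinS; have := iS (delta_mx i 0).
  rewrite -mulmxA mulmx_col_delta -/v Hv => h.
  have /matrixP/(_ i 0) : delta_mx i 0 = 0 :> 'cV[R]_N.
    apply: h => // j jS; rewrite mxE andbT; case: eqP => // ji.
    by rewrite ji iinS in jS.
  by rewrite !mxE !eqxx => /eqP; rewrite oner_eq0.
exists (i |: S); split; first by rewrite cardsU1 iNS cS.
- move=> b hb Vb.
  pose b' := b - b i 0 *: delta_mx i 0.
  have b'0 : b' = 0.
    apply: iS => [j jS|].
      rewrite !mxE andbT; have [->|ji] := eqVneq j i; first by rewrite mulr1 subrr.
      by rewrite mulr0 subr0 hb // !inE negb_or ji.
    by rewrite -mulmxA mulmxBr Vb -scalemxAr mulmx_col_delta sub0r -/v mulmxN -scalemxAr Hv scaler0 oppr0.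
  have be : b = b i 0 *: delta_mx i 0 by apply/eqP; rewrite -subr_eq0; apply/eqP.
  move: Vb; rewrite be -scalemxAr mulmx_col_delta -/v => /eqP.
  by rewrite scaler_eq0 (negPf vn0) orbF => /eqP ->; rewrite scale0r.
- move=> u hu un0.
  have [u' uE] : exists u', u = H^T *m u' by apply: Hu; apply: hu; rewrite !inE eqxx.
  rewrite uE -qform_congr.
  apply: qS; last by apply: contra un0 => /eqP u'0; rewrite uE u'0 mulmx0.
  move=> j jS; rewrite -mulmx_col_delta -mulmxA mulmx_col_delta mulmxA.
  have -> : u'^T *m H = u^T by rewrite uE trmx_mul trmxK.
  by apply: hu; rewrite !inE jS orbT.
Qed.

End Selection.

(** * Multi-affine functions and the barrier argument *)

Section MultiAffine.
Variables (R : realType) (V : finType).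
Implicit Types (u lo : V -> R) (v w t : V) (f g : (V -> R) -> R).

Definition upd u v (r : R) : V -> R := fun w => if w == v then r else u w.
(* On multi-affine functions this difference is the partial derivative. *)
Definition dv v f : (V -> R) -> R := fun u => f (upd u v 1) - f (upd u v 0).
Definition maff f := forall u v r, f (upd u v r) = f (upd u v 0) + r * dv v f u.
(** For multi-affine f the two sides differ by f_v f_w - f f_vw, which does not depend on the
    coordinates v and w; the corners of the unit square thus give the inequality at every point. *)
Definition ray f := forall u v w, v != w ->
  f (upd (upd u v 0) w 0) * f (upd (upd u v 1) w 1) <=
  f (upd (upd u v 1) w 0) * f (upd (upd u v 0) w 1).
Definition above lo u := forall v, lo v <= u v.
Definition nneg lo f := forall u, above lo u -> 0 <= f u.

Lemma upd_upd u v r s : upd (upd u v r) v s = upd u v s.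
Proof. by apply/funext => w; rewrite /upd; case: eqP. Qed.

Lemma upd_id u v : upd u v (u v) = u.
Proof. by apply/funext => w; rewrite /upd; case: eqP => // ->. Qed.

Lemma updC u v w r s : v != w -> upd (upd u v r) w s = upd (upd u w s) v r.
Proof.
move=> vw; apply/funext => x; rewrite /upd.
by case: (eqVneq x w) => // ->; rewrite eq_sym (negPf vw).
Qed.

Lemma upd_eq u v r : upd u v r v = r. Proof. by rewrite /upd eqxx. Qed.

Lemma upd_neq u v w r : w != v -> upd u v r w = u w.
Proof. by rewrite /upd => /negPf ->. Qed.

Lemma dv_upd f u v r : dv v f (upd u v r) = dv v f u.
Proof. by rewrite /dv !upd_upd. Qed.

Lemma maffE f u v r : maff f -> f (upd u v r) = f u + (r - u v) * dv v f u.
Proof.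
by move=> mf; have h := mf u v (u v); rewrite upd_id in h; rewrite mf h; ring.
Qed.

Lemma dvC f u v w : dv v (dv w f) u = dv w (dv v f) u.
Proof.
have [->//|vw] := eqVneq v w; rewrite /dv !(updC _ _ _ vw); ring.
Qed.

Lemma dvv f u v : dv v (dv v f) u = 0.
Proof. by rewrite /dv !upd_upd subrr. Qed.

Lemma maff_dv f v : maff f -> maff (dv v f).
Proof.
move=> mf u w r; have [->|vw] := eqVneq v w.
  by rewrite !dv_upd dvv mulr0 addr0.
rewrite /dv -!(updC _ _ _ vw) (mf (upd u v 1) w r) (mf (upd u v 0) w r) /dv.
by ring.
Qed.

Lemma ray_dv f u v w : maff f -> ray f -> v != w ->
  f u * dv v (dv w f) u <= dv v f u * dv w f u.
Proof.
move=> mf rf vw; have := rf u v w vw.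
have mw := maff_dv w mf.
have e r s : f (upd (upd u v r) w s) = f u + (r - u v) * dv v f u +
    (s - u w) * (dv w f u + (r - u v) * dv v (dv w f) u).
  rewrite maffE // upd_neq 1?eq_sym // (maffE u v r mf).
  by rewrite (maffE u v r mw).
by rewrite !e; nra.
Qed.

Lemma above_upd lo u v r : above lo u -> lo v <= r -> above lo (upd u v r).
Proof. by move=> h hr w; rewrite /upd; case: eqP => // ->. Qed.

(** There are finitely many coordinates, so u is reached from [lo] by raising them one after
    another. *)
Lemma above_ind lo (P : (V -> R) -> Prop) : P lo ->
  (forall u v r, above lo u -> P u -> u v <= r -> P (upd u v r)) ->
  forall u, above lo u -> P u.
Proof.
move=> P0 Pupd u hu.
pose mix (l : seq V) : V -> R := fun v => if v \in l then u v else lo v.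
have am l : above lo (mix l) by move=> v; rewrite /mix; case: ifP.
have Pmix l : P (mix l).
  elim: l => [|v l IH]; first by rewrite /mix.
  have -> : mix (v :: l) = upd (mix l) v (u v).
    apply/funext => w; rewrite /mix /upd inE.
    by have [->|] := eqVneq w v.
  by apply: Pupd => //; rewrite /mix; case: ifP.
have -> : u = mix (enum V) by apply/funext => v; rewrite /mix mem_enum.
exact: Pmix.
Qed.

Lemma nneg_dv lo f v : maff f -> nneg lo f -> nneg lo (dv v f).
Proof.
move=> mf nf u hu; rewrite leNgt; apply/negP => d0.
have fu := nf u hu.
(* Raising coordinate v to this value would give f = -1. *)
pose r := u v + (f u + 1) / - dv v f u.
have ur : u v <= r by rewrite lerDl divr_ge0 ?addr_ge0 // oppr_ge0 ltW.
have := nf _ (above_upd hu (le_trans (hu v) ur)).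
rewrite maffE //.
have -> : (r - u v) * dv v f u = - (f u + 1).
  by rewrite /r addrAC subrr add0r invrN mulrN mulNr mulfVK ?lt_eqF.
by lra.
Qed.

Lemma nneg_mono lo f u u' : maff f -> nneg lo f -> above lo u -> above u u' ->
  f u <= f u'.
Proof.
move=> mf nf hu; move: u'; apply: above_ind => // w v r uw h wr.
have hw : above lo w by move=> x; apply: le_trans (hu x) (uw x).
rewrite maffE //; apply: (le_trans h); rewrite lerDl; apply: mulr_ge0; first by rewrite subr_ge0.
exact: (nneg_dv v mf nf hw).
Qed.

(** The c's stand for f, f_y, f_z, f_yz at one point and the d's for the same derivatives of f_t.
    The last two hypotheses are the Rayleigh inequalities for (y, t) shifted along z and for (z, t)
    shifted along y. The second conclusion says that the step does not increase the logarithmic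
    derivative in t. *)
Lemma barrier_ineq (c0 c1 c2 c3 d0 d1 d2 d3 L : R) :
  0 < c0 -> 0 <= c1 -> 0 <= c2 -> 0 <= c3 ->
  0 <= d0 -> 0 <= d1 -> 0 <= d2 -> 0 <= d3 -> 0 < L ->
  L * (c1 + c2) <= c0 -> c0 * c3 <= c1 * c2 ->
  (forall b, (c0 + b * c2) * (d1 + b * d3) <= (c1 + b * c3) * (d0 + b * d2)) ->
  (forall a, (c0 + a * c1) * (d2 + a * d3) <= (c2 + a * c3) * (d0 + a * d1)) ->
  0 <= c1 + c2 - L * c3 /\ (d1 + d2 - L * d3) * c0 <= (c1 + c2 - L * c3) * d0.
Proof.
move=> c0p c1p c2p c3p d0p d1p d2p d3p Lp LB cc h1 h2.
pose B := c1 + c2; pose a0 := (d1 + d2) * c0 - d0 * B.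
pose a1 := d3 * c0 - d0 * c3.
have a0le : a0 <= 0 by have := h1 0; have := h2 0; rewrite /a0 /B; lra.
have Bp : 0 <= B by rewrite addr_ge0.
split.
  have h : L * c3 * c0 <= B * c0 by rewrite /B in LB *; nra.
  by rewrite subr_ge0; move: h; rewrite ler_pM2r.
(* Multiplied by c0, the difference to be bounded is L (c0 a1 - B a0) + (- a0) (c0 - L B), and its
   second term is nonnegative. *)
suff key : B * a0 <= c0 * a1.
  rewrite -subr_ge0; suff : 0 <= c0 * ((c1 + c2 - L * c3) * d0 - (d1 + d2 - L * d3) * c0).
    by rewrite pmulr_rge0.
  have -> : c0 * ((c1 + c2 - L * c3) * d0 - (d1 + d2 - L * d3) * c0) =
     L * (c0 * a1 - B * a0) + (- a0) * (c0 - L * B).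
    by rewrite /a0 /a1 /B; ring.
  by rewrite addr_ge0 // mulr_ge0 ?subr_ge0 ?oppr_ge0 // ltW.
have [B0|Bn0] := eqVneq B 0.
  have c10 : c1 = 0 by rewrite /B in B0; lra.
  have c30 : c3 = 0.
    apply/eqP; rewrite eq_le c3p andbT -(pmulr_rle0 _ c0p) (le_trans cc) //.
    by rewrite c10 mul0r.
  by rewrite B0 mul0r /a1 c30 mulr0 subr0 mulr_ge0 ?mulr_ge0 // ltW.
have B0 : 0 < B by rewrite lt_neqAle eq_sym Bn0.
have := h1 (- c0 / B); have := h2 (- c0 / B).
set x := - c0 / B => k2 k1.
have xB : x * B = - c0 by rewrite /x mulfVK.
(* the sum of the two Rayleigh inequalities at the common shift x = - c0 / B *)
have k : 0 <= - (a0 + 2 * x * a1 + x ^+ 2 * (d3 * B - (d1 + d2) * c3)).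
  by rewrite /a0 /a1 /B; move: k1 k2; lra.
have kB : 0 <= B * c0 * a1 - (B ^+ 2 - c0 * c3) * a0.
  have -> : B * c0 * a1 - (B ^+ 2 - c0 * c3) * a0 =
     B ^+ 2 * - (a0 + 2 * x * a1 + x ^+ 2 * (d3 * B - (d1 + d2) * c3)) +
       (x * B + c0) * (2 * a1 * B + (x * B - c0) * (d3 * B - (d1 + d2) * c3)).
    by rewrite /a0 /a1; ring.
  by rewrite xB addNr mul0r addr0 mulr_ge0 // sqr_ge0.
rewrite -(ler_pM2l B0) -subr_ge0.
have -> : B * (c0 * a1) - B * (B * a0) = (B * c0 * a1 - (B ^+ 2 - c0 * c3) * a0) +
  (c0 * c3) * - a0 by ring.
by rewrite addr_ge0 // mulr_ge0 ?mulr_ge0 ?oppr_ge0 // ltW.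
Qed.

Definition pos_or_zero lo f :=
  (forall u, above lo u -> 0 < f u) \/ (forall u, above lo u -> f u = 0).

Lemma zero_dv lo f v : maff f -> (forall u, above lo u -> f u = 0) ->
  forall u, above lo u -> dv v f u = 0.
Proof.
move=> mf zf u hu.
have h : above lo (upd u v (u v + 1)) by apply: above_upd => //; have := hu v; lra.
have := zf _ h; rewrite maffE // zf // add0r addrAC subrr add0r mul1r.
by [].
Qed.

(** At a zero u0 the barrier kills all first derivatives, so f vanishes everywhere above u0. By
    monotonicity f(u) is at most the value at the coordinatewise maximum of u and u0, which is 0. *)
Lemma nneg_pos_or_zero lo f L : 0 < L -> maff f -> nneg lo f ->
  (forall u v, above lo u -> L * dv v f u <= f u) -> pos_or_zero lo f.
Proof.
move=> L0 mf nf bf.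
have [[u0 [hu0 f0]]|h] := pselect (exists u, above lo u /\ f u = 0); last first.
  left=> u hu; rewrite lt_neqAle nf // andbT; apply/eqP => e.
  by apply: h; exists u.
right=> u hu; apply/eqP; rewrite eq_le nf // andbT.
pose w : V -> R := fun v => Num.max (u v) (u0 v).
have uw : above u w by move=> v; rewrite le_max lexx.
have u0w : above u0 w by move=> v; rewrite le_max lexx orbT.
apply: le_trans (nneg_mono mf nf hu uw) _.
suff -> : f w = 0 by [].
move: w u0w {uw}; apply: above_ind => // w v r hw fw _.
have lw : above lo w by move=> x; apply: le_trans (hu0 x) (hw x).
have d0 := nneg_dv v mf nf lw.
have := bf w v lw; rewrite fw pmulr_rle0 // => d1.
have -> : f (upd w v r) = f w + (r - w v) * dv v f w by exact: maffE.
by rewrite fw (_ : dv v f w = 0) ?mulr0 ?addr0 //; apply/eqP; rewrite eq_le d1 d0.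
Qed.

(** When a coordinate v grows, f_y / f cannot grow because f f_vy <= f_v f_y, and likewise for z;
    the barrier need only be checked at the lowest point. *)
Lemma barrier_corner lo f y z L : 0 < L -> maff f -> ray f ->
  (forall u, above lo u -> 0 < f u) ->
  L * (dv y f lo + dv z f lo) <= f lo ->
  forall u, above lo u -> L * (dv y f u + dv z f u) <= f u.
Proof.
move=> L0 mf rf pf h0; apply: above_ind => // u v r hu h ur.
have nf : nneg lo f by move=> p hp; exact/ltW/pf.
have f0 := pf u hu.
have lr : lo v <= r by apply: le_trans ur.
have := pf _ (above_upd hu lr); rewrite !maffE //; try exact: maff_dv.
set rho := r - u v; have rho0 : 0 <= rho by rewrite subr_ge0.
set fv := dv v f u => f1.
have fv0 : 0 <= fv by exact: (nneg_dv v mf nf hu).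
have s t : f u * dv v (dv t f) u <= fv * dv t f u.
  have [->|vt] := eqVneq v t; last exact: ray_dv.
  by rewrite dvv mulr0 mulr_ge0 //; apply: (nneg_dv _ mf nf hu).
rewrite -(ler_pM2l f0).
have := s y; have := s z; move: h.
set fy := dv y f u; set fz := dv z f u; set gy := dv v (dv y f) u.
set gz := dv v (dv z f) u => h sz sy.
have h1 := ler_wpM2l (mulr_ge0 (ltW L0) rho0) (lerD sy sz).
have h2 := ler_wpM2r (ltW f1) h.
by lra.
Qed.

(** * One step of the barrier argument *)

Definition Tstep y z (x : R) f : (V -> R) -> R := fun u =>
  let u' := upd (upd u y 0) z x in dv y f u' + dv z f u'.

Section Step.
Variables (f : (V -> R) -> R) (lo : V -> R) (y z : V) (x l1 l2 : R).
Hypotheses (mf : maff f) (yz : y != z).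
Hypotheses (loy : lo y = l1) (loz : lo z = x + l2).
Let L := l1 + l2.

(** Moving the evaluation point from (0, x) to (l1, x + l2) changes g_y by l2 g_yz and g_z by l1
    g_yz. *)
Lemma TstepE g u : maff g -> let u0 := upd (upd u y (lo y)) z (lo z) in
  Tstep y z x g u = dv y g u0 + dv z g u0 - L * dv y (dv z g) u0.
Proof.
move=> mg u0; rewrite /Tstep.
have -> : upd (upd u y 0) z x = upd (upd u0 z x) y 0.
  rewrite /u0 upd_upd -(updC _ _ _ (_ : z != y)) 1?eq_sym //.
  by rewrite [upd (upd u y _) z x]updC // upd_upd updC 1?eq_sym.
rewrite dv_upd [in X in _ + X]updC 1?eq_sym // dv_upd.
rewrite (maffE _ _ _ (maff_dv y mg)) (maffE _ _ _ (maff_dv z mg)).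
have -> : u0 z = x + l2 by rewrite /u0 upd_eq loz.
have -> : u0 y = l1 by rewrite /u0 upd_neq // upd_eq loy.
by rewrite (dvC g u0 z y) /L; ring.
Qed.

Lemma dv_Tstep g t u : t != y -> t != z -> dv t (Tstep y z x g) u = Tstep y z x (dv t g) u.
Proof.
move=> ty tz; rewrite /Tstep !(dvC g _ _ t) {1}/dv.
have e r : upd (upd (upd u t r) y 0) z x = upd (upd (upd u y 0) z x) t r.
  by rewrite (updC _ _ _ ty) (updC _ _ _ tz).
by rewrite !e [dv t (dv y g) _]/dv [dv t (dv z g) _]/dv; ring.
Qed.

Hypotheses (rf : ray f) (L0 : 0 < L) (nf : nneg lo f) (pz : pos_or_zero lo f).
Hypothesis bf : forall u, above lo u -> L * (dv y f u + dv z f u) <= f u.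

Lemma Tstep_zero : (forall u, above lo u -> f u = 0) ->
  forall u, above lo u -> Tstep y z x f u = 0.
Proof.
move=> zf u hu; rewrite TstepE //.
have hu0 : above lo (upd (upd u y (lo y)) z (lo z)).
  by apply: above_upd => //; apply: above_upd.
have z1 v p : above lo p -> dv v f p = 0 by exact: (zero_dv v mf zf).
rewrite !z1 // (zero_dv y (maff_dv z mf) _ hu0) => [|p]; last exact: z1.
by rewrite mulr0 subr0 addr0.
Qed.

Lemma Tstep_ge0 : nneg lo (Tstep y z x f).
Proof.
move=> u hu; case: pz => [pf|zf]; last by rewrite Tstep_zero.
rewrite TstepE //; set u0 := upd _ _ _.
have hu0 : above lo u0 by apply: above_upd => //; apply: above_upd.
have nn v : nneg lo (dv v f) by apply: nneg_dv.
(* The first conclusion concerns the c's alone, so the d's are set to 0. *)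
have [] := @barrier_ineq (f u0) (dv y f u0) (dv z f u0) (dv y (dv z f) u0) 0 0 0 0 L
  => //; try exact: nn.
- exact: pf.
- exact: (nneg_dv y (maff_dv z mf) (nn z)).
- exact: bf.
- exact: ray_dv.
- by move=> b; rewrite !mulr0 !addr0 !mulr0.
- by move=> b; rewrite !mulr0 !addr0 !mulr0.
Qed.

(** Cross-multiplied comparison of logarithmic derivatives in t, after the step at u and before it
    at the corner; this is how the barrier of the remaining pairs is inherited. *)
Lemma Tstep_barrier u t : (forall u, above lo u -> 0 < f u) ->
  above lo u -> t != y -> t != z ->
  dv t (Tstep y z x f) u * f (upd (upd u y (lo y)) z (lo z)) <=
  Tstep y z x f u * dv t f (upd (upd u y (lo y)) z (lo z)).
Proof.
move=> pf hu ty tz; rewrite dv_Tstep // !TstepE //; last exact: maff_dv.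
set u0 := upd (upd u y (lo y)) z (lo z).
have hu0 : above lo u0 by apply: above_upd => //; apply: above_upd.
rewrite -/u0.
have nn v : nneg lo (dv v f) by apply: nneg_dv.
have nnn v w : nneg lo (dv v (dv w f)) by apply: nneg_dv => //; apply: maff_dv.
have n3 : 0 <= dv y (dv z (dv t f)) u0.
  by apply: (nneg_dv y (maff_dv _ (maff_dv _ mf))) hu0 => //.
suff [] : 0 <= dv y f u0 + dv z f u0 - L * dv y (dv z f) u0 /\
  (dv y (dv t f) u0 + dv z (dv t f) u0 - L * dv y (dv z (dv t f)) u0) * f u0 <=
  (dv y f u0 + dv z f u0 - L * dv y (dv z f) u0) * dv t f u0 by [].
apply: (@barrier_ineq (f u0)) => //; try exact: nn; try exact: nnn.
- exact: pf.
- exact: bf.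
- exact: ray_dv.
- move=> b; have := @ray_dv f (upd u0 z (u0 z + b)) y t mf rf.
  rewrite eq_sym => /(_ ty).
  have sh g : maff g -> g (upd u0 z (u0 z + b)) = g u0 + b * dv z g u0.
    by move=> /maffE ->; rewrite addrAC subrr add0r.
  rewrite (sh f mf) (sh _ (maff_dv y (maff_dv t mf))) (sh _ (maff_dv y mf)).
  by rewrite (sh _ (maff_dv t mf)) (dvC (dv t f) _ z y) (dvC f _ z y).
- move=> a; have := @ray_dv f (upd u0 y (u0 y + a)) z t mf rf.
  rewrite eq_sym => /(_ tz).
  have sh g : maff g -> g (upd u0 y (u0 y + a)) = g u0 + a * dv y g u0.
    by move=> /maffE ->; rewrite addrAC subrr add0r.
  rewrite (sh f mf) (sh _ (maff_dv z (maff_dv t mf))) (sh _ (maff_dv z mf)).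
  by rewrite (sh _ (maff_dv t mf)).
Qed.

End Step.

End MultiAffine.

(** * Iterating the barrier step over all pairs of variables *)

Section Chain.
Variables (R : realType) (V : finType) (m : nat) (y z : 'I_m -> V).
Variables (p : nat -> (V -> R) -> R) (lo : V -> R) (x : 'I_m -> R) (l1 l2 : R).
Hypotheses (yinj : injective y) (zinj : injective z).
Hypothesis yz : forall i j, y i != z j.
Hypothesis yzcover : forall v, exists j, v = y j \/ v = z j.
Hypothesis loy : forall j, lo (y j) = l1.
Hypothesis loz : forall j, lo (z j) = x j + l2.
Hypothesis L0 : 0 < l1 + l2.
Hypotheses (mp : forall i, maff (p i)) (rp : forall i, ray (p i)).
Hypothesis pS : forall j : 'I_m, p j.+1 =1 Tstep (y j) (z j) (x j) (p j).
Hypothesis pconst : forall i (j : 'I_m) u, (j < i)%N ->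
  dv (y j) (p i) u = 0 /\ dv (z j) (p i) u = 0.
Hypothesis p0 : nneg lo (p 0).
Hypothesis b0 : forall (j : 'I_m) u, above lo u ->
  (l1 + l2) * (dv (y j) (p 0) u + dv (z j) (p 0) u) <= p 0 u.

(** Step i uses the barrier of pair i to preserve nonnegativity; for the later pairs the logarithmic
    derivatives do not increase, so their barriers survive. *)
Lemma barrier_chain i : (i <= m)%N -> nneg lo (p i) /\
  (forall (j : 'I_m) u, (i <= j)%N -> above lo u ->
    (l1 + l2) * (dv (y j) (p i) u + dv (z j) (p i) u) <= p i u).
Proof.
elim: i => [|i IH] im; first by split=> // j u _; exact: b0.
have [nf bf] := IH (ltnW im); pose k := Ordinal im.
(* Each variable either belongs to a pair whose barrier still holds or has derivative zero, so every
   single derivative satisfies the bound required by the dichotomy. *)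
have pz : pos_or_zero lo (p i).
  apply: (nneg_pos_or_zero L0) => // u v hu.
  have d v' : 0 <= dv v' (p i) u by apply: (nneg_dv v' (mp i) nf hu).
  have [j vj] := yzcover v; have [ij|ji] := leqP i j.
    apply: le_trans (bf j u ij hu); rewrite ler_pM2l //.
    by case: vj => ->; rewrite ?lerDl ?lerDr.
  have [dy dz] := pconst u ji.
  by case: vj => ->; rewrite ?dy ?dz mulr0 nf.
have bk u : above lo u -> (l1 + l2) * (dv (y k) (p i) u + dv (z k) (p i) u) <= p i u.
  exact: bf.
have pE : p i.+1 = Tstep (y k) (z k) (x k) (p i) by apply/funext => u; exact: (pS k).
have nq : nneg lo (p i.+1).
  by rewrite pE; apply: (@Tstep_ge0 _ _ _ lo _ _ (x k) l1 l2).
split=> // j u ij hu; case: (pz) => [pf|zf]; last first.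
  have zq w : above lo w -> p i.+1 w = 0.
    by rewrite pE; apply: (@Tstep_zero _ _ _ lo _ _ (x k) l1 l2).
  by rewrite !(zero_dv _ (mp i.+1) zq hu) zq // addr0 mulr0.
have jk : j != k by apply/eqP => jk; move: ij; rewrite jk ltnn.
set u0 := upd (upd u (y k) (lo (y k))) (z k) (lo (z k)).
have hu0 : above lo u0 by apply: above_upd => //; apply: above_upd.
have st t : t != y k -> t != z k ->
    dv t (p i.+1) u * p i u0 <= p i.+1 u * dv t (p i) u0.
  by rewrite pE; apply: (@Tstep_barrier _ _ _ lo _ _ (x k) l1 l2).
have sy : dv (y j) (p i.+1) u * p i u0 <= p i.+1 u * dv (y j) (p i) u0.
  by apply: st; rewrite ?(inj_eq yinj).
have sz : dv (z j) (p i.+1) u * p i u0 <= p i.+1 u * dv (z j) (p i) u0.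
  by apply: st; rewrite ?(inj_eq zinj) // eq_sym.
have bj := bf j u0 (ltnW ij) hu0; have f0 := pf u0 hu0.
rewrite -(ler_pM2r f0); have q0 := nq u hu.
have := ler_wpM2l q0 bj; have := ler_wpM2l (ltW L0) (lerD sy sz); lra.
Qed.

End Chain.

(** * The barrier argument for a determinantal pencil *)

Definition diagf (K : comNzRingType) n (c : 'I_n -> K) : 'M[K]_n := diag_mx (\row_j c j).

(** Variant of [upd] with values in any type, so that diagonal entries may be polynomials. *)
Definition fupd (T : Type) n (c : 'I_n -> T) i r : 'I_n -> T :=
  fun j => if j == i then r else c j.

Lemma diagf_upd (K : comNzRingType) n (c : 'I_n -> K) i r :
  diagf (fupd c i r) = diagf (fupd c i 0) + r *: (delta_mx i 0 *m (delta_mx i (0 : 'I_1))^T).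
Proof.
apply/matrixP => a b; rewrite !mxE big_ord_recl big_ord0 addr0 !mxE !andbT.
rewrite /fupd; have [->|ai] := eqVneq a i; last by rewrite mul0r mulr0 addr0.
by rewrite mul0rn add0r mul1r [b == i]eq_sym mulr_natr.
Qed.

Lemma det_diagf_affine (K : comNzRingType) n (c : 'I_n -> K) (N : 'M[K]_n) i r :
  \det (diagf (fupd c i r) + N) = \det (diagf (fupd c i 0) + N) +
    r * (\det (diagf (fupd c i 1) + N) - \det (diagf (fupd c i 0) + N)).
Proof.
rewrite (diagf_upd _ _ r) (diagf_upd _ _ 1) scale1r ![diagf _ + _ + N]addrAC.
exact: det_rank1_affine.
Qed.

Lemma det_diagf_block (K : comNzRingType) m (c : 'I_(m + m) -> K) (N : 'M[K]_m) :
  \det (diagf c + block_mx 0 0 0 N) =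
  (\prod_j c (lshift m j)) * \det (diagf (fun j => c (rshift m j)) + N).
Proof.
have -> : diagf c + block_mx 0 0 0 N =
  block_mx (diagf (fun j => c (lshift m j))) 0 0 (diagf (fun j => c (rshift m j)) + N).
  have -> : diagf c = block_mx (diagf (fun j => c (lshift m j))) 0 0
      (diagf (fun j => c (rshift m j))).
    rewrite /diagf -diag_mx_row; congr (diag_mx _); apply/rowP => j; rewrite !mxE.
    by case: splitP => l jl; rewrite mxE; congr c; apply: val_inj.
  by rewrite add_block_mx !addr0.
rewrite det_lblock det_diag; congr (_ * _).
by apply: eq_bigr => j _; rewrite mxE.
Qed.

Lemma detpoly_diagf (K : comNzRingType) n (c d : 'I_n -> K) (N : 'M[K]_n) :
  detpoly (diagf c + N) (diagf d) =
  \det (diagf (fun j => (c j)%:P + d j *: 'X) + map_mx polyC N).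
Proof.
rewrite /detpoly; congr (\det _); apply/matrixP => i j.
rewrite !mxE polyCD addrAC; congr (_ + _).
by case: (i == j); rewrite ?mulr1n ?mulr0n ?polyC0 ?mulr0 ?addr0 // -mul_polyC mulrC.
Qed.

Lemma coefM_congr (K : nzRingType) (p p' q q' : {poly K}) k :
  p = p' -> q = q' -> (p * q)`_k = (p' * q')`_k.
Proof. by move=> -> ->. Qed.

(** * The intermediate polynomials of the barrier step *)

Section State.
Variables (R : realType) (m k : nat) (M : 'M[R]_m) (b x : 'I_m -> R).
Hypotheses (sM : M^T = M) (b_ge0 : forall j, 0 <= b j).
Local Notation V := 'I_(m + m).
Implicit Types (u : V -> R) (v w : V).

(* [pst i] is the polynomial obtained after the first i operators of the
   barrier step: the indices [lshift m j] and [rshift m j] stand for y_j and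
   z_j, and those with j < i are no longer variables. *)
Definition act i v : bool :=
  match split v with inl j => (i <= j)%N | inr j => (i <= j)%N end.
Definition cst v : R := match split v with inl j => 1 | inr j => x j end.
(** An active pair contributes the factor y_j + s b_j and a diagonal entry z_j free of s; after its
    step the factor is 1 and the entry is x_j + s b_j. *)
Definition slope i v : R := match split v with
  inl j => if (i <= j)%N then b j else 0 | inr j => if (i <= j)%N then 0 else b j end.
Definition Kst : 'M[R]_(m + m) := block_mx 0 0 0 (- M).
Definition Yst i u := diagf (fun v => if act i v then u v else cst v) + Kst.
Definition pst i u := dcoef k (Yst i u) (diagf (slope i)) 0.

Lemma split_l (j : 'I_m) : split (lshift m j) = inl j.
Proof. by rewrite (unsplitK (inl j)). Qed.
Lemma split_r (j : 'I_m) : split (rshift m j) = inr j.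
Proof. by rewrite (unsplitK (inr j)). Qed.

Lemma Yst_upd_inactive i v u r : ~~ act i v -> Yst i (upd u v r) = Yst i u.
Proof.
move=> nav; congr (diagf _ + _); apply/funext => w; rewrite /upd.
by have [->|//] := eqVneq w v; rewrite (negPf nav).
Qed.

Lemma Yst_upd i v : exists e : 'cV[R]_(m + m),
  forall u r, Yst i (upd u v r) = Yst i (upd u v 0) + r *: (e *m e^T).
Proof.
have [av|nav] := boolP (act i v).
  exists (delta_mx v 0) => u s; rewrite /Yst addrAC; congr (_ + _).
  pose c v := if act i v then u v else cst v.
  have h t : diagf (fun w => if act i w then upd u v t w else cst w) = diagf (fupd c v t).
    congr diagf; apply/funext => w; rewrite /fupd /upd /c.
    by have [->|//] := eqVneq w v; rewrite av.
  by rewrite !h diagf_upd.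
by exists 0 => u s; rewrite mul0mx scaler0 addr0 !Yst_upd_inactive.
Qed.

Lemma pst_maff i : maff (pst i).
Proof.
move=> u v r; have [e he] := Yst_upd i v.
by rewrite /dv /pst he dcoef_affine (he u 1) scale1r.
Qed.

Lemma Yst_sym i u : (Yst i u)^T = Yst i u.
Proof.
rewrite linearD /= /diagf tr_diag_mx /Kst tr_block_mx !trmx0.
by rewrite linearN /= sM.
Qed.

Lemma qform_diagf n (c : 'I_n -> R) (a : 'cV[R]_n) :
  qform (diagf c) a = \sum_j c j * a j 0 ^+ 2.
Proof.
rewrite /qform -mulmxA mul_diag_mx mxE; apply: eq_bigr => j _.
by rewrite !mxE; ring.
Qed.

Lemma pst_ray i : ray (pst i).
Proof.
move=> u v w vw.
have [ev hv] := Yst_upd i v; have [ew hw] := Yst_upd i w.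
have e10 : Yst i (upd (upd u v 1) w 0) = Yst i (upd (upd u v 0) w 0) + ev *m ev^T.
  by rewrite !(updC _ _ _ vw) hv scale1r.
have e01 : Yst i (upd (upd u v 0) w 1) = Yst i (upd (upd u v 0) w 0) + ew *m ew^T.
  by rewrite hw scale1r.
have e11 : Yst i (upd (upd u v 1) w 1) =
    Yst i (upd (upd u v 0) w 0) + ev *m ev^T + ew *m ew^T.
  by rewrite hw e10 scale1r.
rewrite /pst e10 e01 e11; apply: rayleigh; first exact: Yst_sym.
  by rewrite /diagf tr_diag_mx.
move=> a; rewrite qform_diagf sumr_ge0 // => j _; rewrite mulr_ge0 ?sqr_ge0 //.
by rewrite /slope; case: split => l; case: ifP.
Qed.

Lemma pstE i u : pst i u =
  ((\prod_(j < m) (if (i <= j)%N then (u (lshift m j))%:P + b j *: 'X else 1)) *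
   \det (diagf (fun j : 'I_m => if (i <= j)%N then (u (rshift m j))%:P
               else (x j)%:P + b j *: 'X) + map_mx polyC (- M)))`_k.
Proof.
rewrite /pst dcoefE scale0r addr0 /Yst detpoly_diagf /Kst map_block_mx !map_mx0.
rewrite det_diagf_block; apply: coefM_congr; last congr (\det (_ + _)).
  apply: eq_bigr => j _; rewrite /act /slope /cst split_l.
  by case: ifP => // _; rewrite scale0r addr0.
congr diagf; apply/funext => j; rewrite /act /slope /cst split_r.
by case: ifP => // _; rewrite scale0r addr0.
Qed.

Lemma pst_inactive i (j : 'I_m) u : (j < i)%N ->
  dv (lshift m j) (pst i) u = 0 /\ dv (rshift m j) (pst i) u = 0.
Proof.
move=> ji.
have nl : ~~ act i (lshift m j) by rewrite /act split_l -ltnNge.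
have nr : ~~ act i (rshift m j) by rewrite /act split_r -ltnNge.
by rewrite /dv /pst !Yst_upd_inactive // !subrr.
Qed.

(** In the variables of pair i the state is the s^k coefficient of (y + s b_i) P G(z) with G affine,
    so the operator produces P (G(x_i) + s b_i G') = P G(x_i + s b_i). *)
Lemma pst_step (i : 'I_m) :
  pst i.+1 =1 Tstep (lshift m i) (rshift m i) (x i) (pst i).
Proof.
move=> u.
pose a0 (l : 'I_m) : {poly R} :=
  if (i < l)%N then (u (lshift m l))%:P + b l *: 'X else 1.
pose c0 (l : 'I_m) : {poly R} :=
  if (i < l)%N then (u (rshift m l))%:P else (x l)%:P + b l *: 'X.
pose P := \prod_(l | l != i) a0 l.
pose G q := \det (diagf (fupd c0 i q) + map_mx polyC (- M)).
have lrE (j l : 'I_m) : (lshift m j == rshift m l) = false by apply/eqP => /eqP; rewrite eq_lrshift.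
have il (l : 'I_m) : l != i -> (i <= l)%N = (i < l)%N.
  by move=> li; rewrite leq_eqVlt; case: eqP => //= e; rewrite -val_eqE /= e eqxx in li.
have pE r s : pst i (upd (upd u (lshift m i) r) (rshift m i) s) =
    ((r%:P + b i *: 'X) * P * G s%:P)`_k.
  rewrite pstE; apply: coefM_congr; last congr (\det (_ + _)).
    rewrite (bigD1 i) //= leqnn upd_neq ?lrE // upd_eq; congr (_ * _).
    apply: eq_bigr => l li; rewrite il // /a0.
    have nl : lshift m l != lshift m i by rewrite (inj_eq (@lshift_inj _ _)).
    by rewrite !upd_neq // lrE.
  congr diagf; apply/funext => l; rewrite /fupd /c0.
  have [->|li] := eqVneq l i; first by rewrite leqnn upd_eq.
  have nr : rshift m l != rshift m i by rewrite (inj_eq (@rshift_inj _ _)).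
  by rewrite il // !upd_neq // eq_sym lrE.
have pS : pst i.+1 u = (P * G ((x i)%:P + b i *: 'X))`_k.
  rewrite pstE; apply: coefM_congr; last congr (\det (_ + _)).
    by rewrite (bigD1 i) //= ltnn mul1r.
  congr diagf; apply/funext => l; rewrite /fupd /c0.
  by have [->|//] := eqVneq l i; rewrite ltnn.
have yz : lshift m i != rshift m i by rewrite lrE.
rewrite pS /Tstep /dv.
have e1 r : upd (upd (upd u (lshift m i) 0) (rshift m i) (x i)) (lshift m i) r =
    upd (upd u (lshift m i) r) (rshift m i) (x i).
  by rewrite -(updC _ _ _ yz) upd_upd.
rewrite !e1 !upd_upd !pE -!coefB -coefD; apply: (congr1 (fun p : {poly R} => p`_k)).
have Gaff q : G q = G 0 + q * (G 1 - G 0) by exact: det_diagf_affine.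
rewrite (Gaff (_ + _)) (Gaff (x i)%:P) polyC0 polyC1; ring.
Qed.

Lemma pst_last u : pst m u = (detpoly (diagf x - M) (diagf b))`_k.
Proof.
rewrite pstE detpoly_diagf big1 ?mul1r => [|j _]; last by rewrite leqNgt ltn_ord.
apply: (congr1 (fun p : {poly R} => p`_k)); congr (\det (diagf _ + _)); apply/funext => j.
by rewrite leqNgt ltn_ord.
Qed.

Lemma pst_first u : pst 0 u =
  (\prod_(j < m) ((u (lshift m j))%:P + b j *: 'X))`_k *
  \det (diagf (fun j => u (rshift m j)) - M).
Proof.
rewrite pstE /= -coefMC -det_map_mx; apply: coefM_congr => //; congr (\det _).
rewrite map_mxD; congr (_ + _); apply/matrixP => i j; rewrite !mxE.
by case: (i == j); rewrite ?mulr1n ?mulr0n ?polyC0.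
Qed.

End State.

(** * Elementary symmetric polynomials, the resolvent and the initial barrier *)

Section Barrier.
Variable R : realType.

Lemma coef_prod_linear m (a b : 'I_m -> R) k :
  (\prod_j ((a j)%:P + b j *: 'X))`_k =
  \sum_(J : {set 'I_m} | #|J| == k)
     (\prod_(j in J) b j) * \prod_(j in ~: J) a j.
Proof.
under eq_bigr => j _ do rewrite addrC.
rewrite bigA_distr coef_sum [RHS]big_mkcond; apply: eq_bigr => J _.
have -> : \prod_i (if i \in J then b i *: 'X else (a i)%:P) =
   ((\prod_(j in J) b j) * \prod_(j in ~: J) a j) *: 'X^#|J| :> {poly R}.
  rewrite (bigID (mem J)) /=.
  rewrite (eq_bigr (fun j => (b j)%:P * 'X)); last by move=> j /= ->; rewrite mul_polyC.
  rewrite big_split /= prodr_const [X in _ * X = _](eq_bigr (fun j => (a j)%:P)).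
    rewrite -!rmorph_prod /= mulrAC -rmorphM /= mul_polyC; congr (_ * _ *: _).
    by apply: eq_bigl => j; rewrite !inE.
  by move=> j /= /negPf ->.
by rewrite coefZ coefXn eq_sym; case: eqP; rewrite ?mulr1 ?mulr0.
Qed.

Definition elsym m k (b : 'I_m -> R) : R :=
  \sum_(J : {set 'I_m} | #|J| == k) \prod_(j in J) b j.
(** The elementary symmetric polynomial of degree k in the variables other than [b i]. For the last
    index its quotient by [elsym k b] is delta_k. *)
Definition elsymN m k (b : 'I_m -> R) (i : 'I_m) : R :=
  \sum_(J : {set 'I_m} | (#|J| == k) && (i \notin J)) \prod_(j in J) b j.

Lemma elsym_gt0 m k (b : 'I_m -> R) : (forall j, 0 < b j) -> (k <= m)%N -> 0 < elsym k b.
Proof.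
move=> b0 km.
have [J /eqP cJ] : exists J : {set 'I_m}, #|J| = k.
  have : (0 < #|[set J : {set 'I_m} | #|J| == k]|)%N.
    by rewrite card_draws card_ord bin_gt0.
  by case/card_gt0P => J; rewrite inE => /eqP; exists J.
rewrite /elsym (bigD1 J) //= ltr_pwDl ?prodr_gt0 //.
by apply: sumr_ge0 => I _; apply: prodr_ge0 => j _; exact: ltW.
Qed.

Lemma dotC n (p q : 'cV[R]_n) : (p^T *m q) 0 0 = (q^T *m p) 0 0.
Proof. by rewrite -[p^T *m q]trmxK trmx_mul trmxK [LHS]mxE. Qed.

Lemma qform_lin2 n (Y : 'M[R]_n) (p q : 'cV[R]_n) s t : Y^T = Y ->
  qform Y (s *: p + t *: q) =
  s ^+ 2 * qform Y p + 2 * s * t * (p^T *m Y *m q) 0 0 + t ^+ 2 * qform Y q.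
Proof.
move=> sY.
have e : (q^T *m Y *m p) 0 0 = (p^T *m Y *m q) 0 0.
  by rewrite -mulmxA dotC trmx_mul sY.
rewrite /qform; have -> : (s *: p + t *: q)^T = s *: p^T + t *: q^T.
  by rewrite linearD !linearZ.
have DE (A B : 'M[R]_1) : (A + B) 0 0 = A 0 0 + B 0 0 by rewrite mxE.
have ZE x (A : 'M[R]_1) : (x *: A) 0 0 = x * A 0 0 by rewrite mxE.
rewrite !mulmxDl !mulmxDr -!scalemxAl -!scalemxAr !DE !ZE e.
by ring.
Qed.

(** On the spectrum of M this is the chord bound 1/(c - a) <= (c - 1 + a)/(c (c - 1)) for a in
    [0, 1]; it is obtained from values of the forms M and 1 - M, without diagonalising. *)
Lemma resolvent_le m (M : 'M[R]_m) c (e w : 'cV[R]_m) :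
  M^T = M -> possemidef M -> possemidef (1%:M - M) -> 1 < c ->
  (e^T *m e) 0 0 = 1 -> (c%:M - M) *m w = e ->
  c * (c - 1) * (e^T *m w) 0 0 <= c - 1 + qform M e.
Proof.
move=> sM pM p1M c1 ee hw.
have Mw : M *m w = c *: w + (-1) *: e.
  by rewrite scaleN1r -hw mulmxBl mul_scalar_mx opprB addrC subrK.
have s1M : (1%:M - M)^T = 1%:M - M by rewrite linearB /= trmx1 sM.
pose a := (w^T *m w) 0 0; pose r := (e^T *m w) 0 0; pose al := qform M e.
have we : (w^T *m e) 0 0 = r by rewrite dotC.
have DE (A B : 'M[R]_1) : (A + B) 0 0 = A 0 0 + B 0 0 by rewrite mxE.
have ZE x (A : 'M[R]_1) : (x *: A) 0 0 = x * A 0 0 by rewrite mxE.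
have wMw : qform M w = c * a - r.
  by rewrite /qform -mulmxA Mw mulmxDr -!scalemxAr DE !ZE -/a we; ring.
have wMe : (w^T *m M *m e) 0 0 = c * r - 1.
  have -> : w^T *m M = (M *m w)^T by rewrite trmx_mul sM.
  by rewrite dotC Mw mulmxDr -!scalemxAr DE !ZE -/r ee; ring.
(* At an eigenvalue a the two vectors are (1 - a)/(c - a) and a/(c - a) times the component of e.
   The combination (c - 1)(q1 + q2) + q1 then amounts to a (1 - a)/(c - a), exactly the gap to be
   shown nonnegative. *)
have q1 : 0 <= qform M ((1 - c) *: w + 1 *: e) by exact: pM.
have q2 : 0 <= qform (1%:M - M) (c *: w + (-1) *: e) by exact: p1M.
have h1 : qform M ((1 - c) *: w + 1 *: e) =
   (1 - c) ^+ 2 * (c * a - r) + 2 * (1 - c) * (c * r - 1) + al.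
  by rewrite qform_lin2 // wMw wMe /al; ring.
have q1E x : qform 1%:M x = (x^T *m x) 0 0 by rewrite /qform mulmx1.
have h2 : qform (1%:M - M) (c *: w + (-1) *: e) = (c ^+ 2 * a - 2 * c * r + 1) -
   (c ^+ 2 * (c * a - r) - 2 * c * (c * r - 1) + al).
  rewrite qformD -scaleN1r qformZ !qform_lin2 ?trmx1 // wMw wMe !q1E ee -/a mulmx1 we /al.
  by ring.
have : 0 <= (c - 1) * (qform M ((1 - c) *: w + 1 *: e) +
   qform (1%:M - M) (c *: w + (-1) *: e)) + qform M ((1 - c) *: w + 1 *: e).
  apply: addr_ge0 => //; apply: mulr_ge0; first by rewrite subr_ge0 ltW.
  exact: addr_ge0.
by rewrite h1 h2 -/r -/al => h; rewrite -subr_ge0; apply: le_trans h _; rewrite le_eqVlt; apply/orP; left; apply/eqP; ring.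
Qed.

Lemma posdef_shift m (M : 'M[R]_m) (z : 'I_m -> R) c : possemidef (1%:M - M) ->
  1 < c -> (forall j, c <= z j) -> posdef (diagf z - M).
Proof.
move=> p1M c1 cz x xn0.
have -> : diagf z - M = diagf (fun j => z j - 1) + (1%:M - M).
  rewrite addrA; congr (_ - _); apply/matrixP => i j; rewrite !mxE.
  by case: (i == j); rewrite ?mulr1n ?mulr0n ?addr0 // subrK.
rewrite qformD ltr_pwDl // qform_diagf.
apply: lt_le_trans (_ : (c - 1) * \sum_j x j 0 ^+ 2 <= _).
  by rewrite mulr_gt0 ?subr_gt0 // sqr_sum_gt0.
rewrite mulr_sumr; apply: ler_sum => j _; rewrite ler_wpM2r ?sqr_ge0 //.
by rewrite lerB.
Qed.

(** Relative to det X, the slope is the j-th diagonal entry of the inverse of cI - M. *)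
Lemma det_slope_le m (M : 'M[R]_m) c al (j : 'I_m) X :
  M^T = M -> possemidef M -> possemidef (1%:M - M) -> 1 < c -> M j j <= al ->
  X = diagf (fun=> c) - M ->
  \det (X + delta_mx j 0 *m (delta_mx j (0 : 'I_1))^T) - \det X <=
  (c - 1 + al) / (c * (c - 1)) * \det X.
Proof.
move=> sM pM p1M c1 hal XE0.
have pdX : posdef X by rewrite XE0; apply: (posdef_shift p1M c1).
have Xu := posdef_unit pdX; have dX := posdef_det_gt0 pdX.
pose e : 'cV[R]_m := delta_mx j 0; pose w := invmx X *m e.
have -> : X + e *m e^T = X *m (1%:M + w *m e^T).
  by rewrite mulmxDr mulmx1 mulmxA mulKVmx.
rewrite det_mulmx det_1_rank1 mulrDr mulr1 addrC addKr mulrC ler_pM2r //.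
have XE : X = c%:M - M.
  by rewrite XE0; congr (_ - _); apply/matrixP => i l; rewrite !mxE.
have ee : (e^T *m e) 0 0 = 1.
  by rewrite /e trmx_delta mul_delta_mx mxE !eqxx.
have cc : 0 < c * (c - 1) by rewrite mulr_gt0 ?subr_gt0 // (lt_trans ltr01).
rewrite ler_pdivlMr // mulrC.
apply: le_trans (@resolvent_le _ M c e w sM pM p1M c1 ee _) _.
  by rewrite -XE mulKVmx.
rewrite lerD2l (le_trans _ hal) // /qform /e trmx_delta -rowE -colE !mxE.
by [].
Qed.

Lemma barrier_coef_ge0 m k (M : 'M[R]_m) (b x : 'I_m -> R) (c l1 l2 al dl : R) :
  M^T = M -> possemidef M -> possemidef (1%:M - M) -> (forall j, M j j <= al) ->
  1 < c -> (forall j, 0 < b j) -> 0 < l1 -> 0 < l1 + l2 -> (k <= m)%N ->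
  (forall j, elsymN k b j <= dl * elsym k b) ->
  (l1 + l2) * (dl / l1 + (c - 1 + al) / (c * (c - 1))) <= 1 ->
  (forall j, c <= x j + l2) ->
  0 <= (detpoly (diagf x - M) (diagf b))`_k.
Proof.
move=> sM pM p1M hal c1 b0 l10 L0 km hdl hL hx.
have b_ge0 j : 0 <= b j by exact: ltW.
(* All z_j are lowered to the common value c; the initial barrier is computed at this symmetric
   corner and spreads upward to [lo]. *)
pose lo0 : 'I_(m + m) -> R := fun v => match split v with inl _ => l1 | inr _ => c end.
pose lo : 'I_(m + m) -> R := fun v => match split v with inl _ => l1 | inr j => x j + l2 end.
have lo01 : above lo0 lo by move=> v; rewrite /lo0 /lo; case: split.
have lo0l j : lo0 (lshift m j) = l1 by rewrite /lo0 split_l.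
have lo0r j : lo0 (rshift m j) = c by rewrite /lo0 split_r.
pose p := pst k M b x.
have mp i : maff (p i) by exact: pst_maff.
have rp i : ray (p i) by apply: pst_ray.
have pos u : above lo0 u -> 0 < p 0%N u.
  move=> hu; rewrite /p pst_first mulr_gt0 //.
    rewrite coef_prod_linear.
    apply: lt_le_trans (_ : l1 ^+ (m - k) * elsym k b <= _).
      by rewrite mulr_gt0 ?exprn_gt0 // elsym_gt0.
    rewrite mulr_sumr; apply: ler_sum => J /eqP cJ; rewrite mulrC.
    rewrite ler_wpM2l ?prodr_ge0 //.
    have -> : l1 ^+ (m - k) = \prod_(j in ~: J) l1.
      by rewrite prodr_const cardsCs setCK card_ord cJ.
    apply: ler_prod => j _; rewrite ltW //=.
    by have := hu (lshift m j); rewrite lo0l.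
  apply/posdef_det_gt0/(posdef_shift p1M c1) => j.
  by have := hu (rshift m j); rewrite lo0r.
pose g := \det (diagf (fun=> c) - M).
have p0E a : p 0%N (fun v => match split v with inl j => a j | inr _ => c end) =
    (\sum_(J : {set 'I_m} | #|J| == k)
      (\prod_(j in J) b j) * \prod_(j in ~: J) a j) * g.
  rewrite /p pst_first -coef_prod_linear; congr (_ * _).
    apply: (congr1 (fun p : {poly R} => p`_k)); apply: eq_bigr => j _.
    by rewrite split_l.
  by congr (\det (diagf _ - _)); apply/funext => j; rewrite split_r.
have dlast (J : {set 'I_m}) : #|J| == k -> \prod_(j in ~: J) l1 = l1 ^+ (m - k) :> R.
  by move=> /eqP cJ; rewrite prodr_const cardsCs setCK card_ord cJ.
have p0lo : p 0%N lo0 = l1 ^+ (m - k) * elsym k b * g.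
  rewrite [LHS](p0E (fun=> l1)); congr (_ * _); rewrite mulr_sumr.
  by apply: eq_bigr => J cJ; rewrite dlast // mulrC.
have g0 : 0 < g by apply/posdef_det_gt0/(posdef_shift p1M c1).
have dy j : l1 * dv (lshift m j) (p 0%N) lo0 <= dl * p 0%N lo0.
  (* At y_j = 0 only the sets J containing j contribute. *)
  have e : p 0%N (upd lo0 (lshift m j) 0) =
      l1 ^+ (m - k) * (elsym k b - elsymN k b j) * g.
    have -> : upd lo0 (lshift m j) 0 =
        (fun v => match split v with inl i => fupd (fun=> l1) j 0 i | inr _ => c end).
      apply/funext => v; rewrite /upd /lo0 /fupd.
      case: (split_ordP v) => i ->; rewrite ?(inj_eq (@lshift_inj _ _)) //.
      by rewrite eq_rlshift.
    have eE : elsym k b - elsymN k b j =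
        \sum_(J : {set 'I_m} | (#|J| == k) && (j \in J)) \prod_(i in J) b i.
      by rewrite /elsym (bigID (fun J : {set 'I_m} => j \in J)) /= addrK.
    rewrite p0E eE; congr (_ * _); rewrite mulr_sumr.
    rewrite (bigID (fun J : {set 'I_m} => j \in J)) /= [X in _ + X]big1 ?addr0.
      apply: eq_bigr => J /andP[cJ jJ]; rewrite mulrC -(dlast J cJ); congr (_ * _).
      apply: eq_bigr => i; rewrite inE /fupd => iJ; case: eqP => // ij.
      by rewrite ij jJ in iJ.
    move=> J /andP[_ jJ]; rewrite [X in _ * X](bigD1 j) /= ?inE //.
    by rewrite /fupd eqxx mul0r mulr0.
  have := maffE lo0 (lshift m j) 0 (mp 0%N); rewrite e lo0l p0lo => h.
  have -> : l1 * dv (lshift m j) (p 0%N) lo0 = l1 ^+ (m - k) * elsymN k b j * g by lra.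
  have := hdl j; rewrite -(ler_pM2l (exprn_gt0 (m - k) l10)) -(ler_pM2r g0); lra.
have dz j : dv (rshift m j) (p 0%N) lo0 <= (c - 1 + al) / (c * (c - 1)) * p 0%N lo0.
  have e r : p 0%N (upd lo0 (rshift m j) r) = l1 ^+ (m - k) * elsym k b *
      \det (diagf (fupd (fun=> c) j r) - M).
    rewrite /p pst_first; congr (_ * _).
      transitivity (\prod_(i < m) (l1%:P + b i *: 'X))`_k.
        apply: (congr1 (fun p : {poly R} => p`_k)); apply: eq_bigr => i _.
        by rewrite upd_neq ?lo0l // eq_lrshift.
      rewrite coef_prod_linear mulr_sumr; apply: eq_bigr => J cJ.
      by rewrite dlast // mulrC.
    congr (\det (diagf _ - _)); apply/funext => i; rewrite /upd /fupd.
    by rewrite (inj_eq (@rshift_inj _ _)) lo0r.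
  rewrite p0lo /dv !e -mulrBr mulrCA ler_pM2l; last first.
    by rewrite mulr_gt0 ?exprn_gt0 // elsym_gt0.
  have gE : g = \det (diagf (fupd (fun=> c) j c) - M).
    by congr (\det (diagf _ - _)); apply/funext => i; rewrite /fupd; case: eqP.
  have := det_slope_le sM pM p1M c1 (hal j) (erefl _); rewrite -/g; apply: le_trans.
  have -> : diagf (fun=> c) - M + delta_mx j 0 *m (delta_mx j (0 : 'I_1))^T =
      diagf (fupd (fun=> c) j (c + 1)) - M.
    have -> : (fun=> c) = fupd (fun=> c) j c.
      by apply/funext => i; rewrite /fupd; case: eqP.
    rewrite (diagf_upd _ _ c) addrAC; congr (_ - _).
    rewrite [in RHS](_ : fupd _ j (c + 1) = fupd (fun=> c) j (c + 1)); last first.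
      by apply/funext => i; rewrite /fupd; case: eqP.
    by rewrite [RHS]diagf_upd scalerDl scale1r addrA.
  by rewrite gE !(det_diagf_affine _ _ j c) (det_diagf_affine _ _ j (c + 1)); lra.
have b0' j u : above lo u -> (l1 + l2) * (dv (lshift m j) (p 0%N) u +
    dv (rshift m j) (p 0%N) u) <= p 0%N u.
  move=> hu; apply: (barrier_corner L0 (mp _) (rp _) pos); last first.
    by move=> v; apply: le_trans (hu v).
  have dy' : dv (lshift m j) (p 0%N) lo0 <= dl / l1 * p 0%N lo0.
    by rewrite mulrAC ler_pdivlMr // mulrC.
  have h := lerD dy' (dz j); rewrite -mulrDl in h.
  apply: le_trans (ler_wpM2l (ltW L0) h) _.
  rewrite mulrA ler_piMl //; apply/ltW/pos => v; exact: lexx.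
have [] := @barrier_chain R _ m (@lshift m m) (@rshift m m) p lo x l1 l2
  (@lshift_inj _ _) (@rshift_inj _ _) _ _ _ _ L0 mp rp _ _ _ b0' m (leqnn m).
- by move=> i j; rewrite eq_lrshift.
- by move=> v; case: (split_ordP v) => j ->; exists j; [left | right].
- by move=> j; rewrite /lo split_l.
- by move=> j; rewrite /lo split_r.
- by move=> j u; rewrite /p pst_step.
- by move=> i j u; apply: pst_inactive.
- by move=> u hu; apply/ltW/pos => v; apply: le_trans (hu v).
by move=> /(_ lo (fun v => lexx _)); rewrite /p pst_last.
Qed.

End Barrier.

(** * The optimal barrier *)

Section Core.
Variable R : realType.

Lemma posdef_diagf m (b : 'I_m -> R) : (forall j, 0 < b j) -> posdef (diagf b).
Proof.
move=> b0 z zn0; rewrite qform_diagf; have [j zj] : exists j, z j 0 != 0.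
  apply: contrapT => hz; move/eqP: zn0; apply; apply/matrixP => j l.
  by rewrite [l]ord1 mxE; apply: contrapT => /eqP zj; apply: hz; exists j.
have zj0 : 0 < z j 0 ^+ 2 by rewrite lt_neqAle sqr_ge0 andbT eq_sym sqrf_eq0.
rewrite (bigD1 j) //=; apply: ltr_pwDl; first by rewrite mulr_gt0.
by apply: sumr_ge0 => l _; rewrite mulr_ge0 ?sqr_ge0 ?ltW.
Qed.

(** Exchanging i and j maps the sets avoiding i onto those avoiding j and replaces b j by b i in the
    products. *)
Lemma elsymN_le m k (b : 'I_m -> R) i j : (forall l, 0 <= b l) -> b i <= b j ->
  elsymN k b j <= elsymN k b i.
Proof.
move=> b0 bij; pose s := tperm i j.
rewrite /elsymN (reindex_inj (imset_inj (@perm_inj _ s))) /=.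
rewrite [leLHS](eq_bigl (fun J : {set 'I_m} => (#|J| == k) && (i \notin J))); last first.
  move=> J /=; rewrite card_imset; last exact: perm_inj.
  have -> : (j \in [set s x | x in J]) = (i \in J) => //.
  by rewrite -{1}(tpermL i j) mem_imset //; exact: perm_inj.
apply: ler_sum => J /andP[_ iJ]; rewrite big_imset /=; last by move=> ? ? _ _; exact: perm_inj.
apply: ler_prod => l lJ; rewrite b0 /=.
have [lj|lj] := eqVneq l j; first by rewrite lj tpermR.
by rewrite tpermD // 1?eq_sym //; apply: contraNneq iJ => <-.
Qed.

Lemma elsymN_gt0 m k (b : 'I_m -> R) i : (forall l, 0 < b l) -> (k < m)%N ->
  0 < elsymN k b i.
Proof.
move=> b0 km.
have [J cJ iJ] : exists2 J : {set 'I_m}, #|J| == k & i \notin J.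
  have : (0 < #|[set J : {set 'I_m} | J \subset ~: [set i] & #|J| == k]|)%N.
    by rewrite cards_draws cardsCs setCK cards1 card_ord bin_gt0 subn1 -ltnS prednK // (leq_ltn_trans _ km).
  case/card_gt0P => J; rewrite inE => /andP[sJ cJ]; exists J => //.
  by apply: contraL sJ => iJ; apply/subsetPn; exists i => //; rewrite !inE eqxx.
rewrite /elsymN (bigD1 J) /= ?cJ //= ltr_pwDl ?prodr_gt0 //.
by apply: sumr_ge0 => I _; apply: prodr_ge0 => l _; exact: ltW.
Qed.

Lemma elsymN_lt m k (b : 'I_m -> R) i : (forall l, 0 < b l) -> (0 < k <= m)%N ->
  elsymN k b i < elsym k b.
Proof.
move=> b0 /andP[k0 km].
have [J cJ iJ] : exists2 J : {set 'I_m}, #|J| == k & i \in J.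
  have : (0 < #|[set J : {set 'I_m} | J \subset ~: [set i] & #|J| == k.-1]|)%N.
    rewrite cards_draws cardsCs setCK cards1 card_ord bin_gt0.
    by rewrite -[k.-1]subn1 leq_sub2r.
  case/card_gt0P => J; rewrite inE => /andP[sJ /eqP cJ]; exists (i |: J); last by rewrite !inE eqxx.
  rewrite cardsU1 cJ; have -> : i \notin J.
    by apply: contraL sJ => iJ; apply/subsetPn; exists i => //; rewrite !inE eqxx.
  by rewrite add1n prednK.
rewrite /elsym (bigID (fun J : {set 'I_m} => i \in J)) /= -/(elsymN k b i) ltrDr.
rewrite (bigD1 J) /= ?cJ ?iJ //= ltr_pwDl ?prodr_gt0 //.
by apply: sumr_ge0 => I _; apply: prodr_ge0 => l _; exact: ltW.
Qed.

(** For given c the constraint is made an equality. With e = c - 1 + al, the quantity c - l2 is then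
    (1 - t) e + t al (1 - al) / e plus a constant, and its minimum over e is the squared sum of
    roots on the left of x. *)
Lemma barrier_params (al sg x : R) : 0 <= al -> 0 < sg < 1 ->
  let t := (1 - sg) ^+ 2 in al <= t ->
  (Num.sqrt (al * t) + Num.sqrt ((1 - al) * (1 - t))) ^+ 2 < x ->
  exists c l1 l2 : R, [/\ 1 < c, 0 < l1, 0 < l2, c - l2 < x &
    (l1 + l2) * (sg ^+ 2 / l1 + (c - 1 + al) / (c * (c - 1))) <= 1].
Proof.
move=> al0 /andP[sg0 sg1] t alt hx.
have t0 : 0 < t by rewrite exprn_gt0 // subr_gt0.
have t1 : t < 1 by rewrite /t; nra.
have tE : t = (1 - sg) ^+ 2 by [].
clearbody t; have al1 : al < 1 by apply: le_lt_trans t1.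
pose r := Num.sqrt (al * t); pose q := Num.sqrt ((1 - al) * (1 - t)).
have r2 : r ^+ 2 = al * t by rewrite sqr_sqrtr // mulr_ge0 // ltW.
have q2 : q ^+ 2 = (1 - al) * (1 - t) by rewrite sqr_sqrtr // mulr_ge0 // subr_ge0 ltW.
have r0 : 0 <= r by exact: sqrtr_ge0.
have q0 : 0 <= q by exact: sqrtr_ge0.
have t1' : 0 < 1 - t by rewrite subr_gt0.
(* The minimiser sqrt(t al (1 - al) / (1 - t)) of c - l2; the hypothesis al <= t gives al <= es. *)
pose es := r * q / (1 - t).
have esE : es * (1 - t) = r * q by rewrite /es mulfVK // gt_eqF.
have es_al : al <= es.
  have h : 0 <= t * (1 - al) - al * (1 - t) by lra.
  rewrite ler_pdivlMr // -(@ler_pXn2r _ 2) // ?nnegrE.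
  - rewrite !exprMn r2 q2 -subr_ge0.
    have -> : al * t * ((1 - al) * (1 - t)) - al ^+ 2 * (1 - t) ^+ 2 =
      al * (1 - t) * (t * (1 - al) - al * (1 - t)) by ring.
    by rewrite !mulr_ge0 // ltW.
  - by rewrite mulr_ge0 // ltW.
  - by rewrite mulr_ge0.
(* This shift spends half of the slack below x and makes e > 0 and c > 1 strict even when es =
   al. *)
pose ka := (x - (r + q) ^+ 2) / (2 * (1 - t)).
have kaE : ka * (1 - t) = (x - (r + q) ^+ 2) / 2.
  by rewrite /ka; field; rewrite gt_eqF.
have xr : 0 < x - (r + q) ^+ 2 by rewrite subr_gt0.
have ka0 : 0 < ka by apply: divr_gt0 => //; apply: mulr_gt0.
pose e := es + ka; have eal : al < e by rewrite (le_lt_trans es_al) // ltrDl.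
have e0 : 0 < e by apply: le_lt_trans eal.
pose c := e + 1 - al; have c1 : 1 < c by rewrite /c; lra.
have c0 : 0 < c by lra.
pose l2 := t * c * (c - 1) / e.
have c1' : 0 < c - 1 by rewrite subr_gt0.
have l20 : 0 < l2.
  apply: divr_gt0 => //; apply: mulr_gt0; last by [].
  by apply: mulr_gt0.
(* Now l1 + l2 = l2 / (1 - sg), and the two summands of the constraint equal sg and 1 - sg. *)
pose l1 := l2 * sg / (1 - sg).
have sg1' : 0 < 1 - sg by rewrite subr_gt0.
have l10 : 0 < l1 by apply: divr_gt0 => //; apply: mulr_gt0.
exists c, l1, l2; split=> //.
  have -> : c - l2 = (1 - t) * e + t * al * (1 - al) / e + 1 - al - t * (1 - 2 * al).
    by rewrite /l2 /c; field; rewrite ?gt_eqF.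
  have h : t * al * (1 - al) / e <= r * q.
    rewrite ler_pdivrMr // -(ler_pM2r t1').
    have -> : r * q * e * (1 - t) = r ^+ 2 * q ^+ 2 + r * q * ka * (1 - t).
      have -> : r * q * e * (1 - t) = r * q * (es * (1 - t)) + r * q * ka * (1 - t).
        by rewrite /e; ring.
      by rewrite esE; ring.
    rewrite r2 q2; have : 0 <= r * q * ka * (1 - t).
      apply: mulr_ge0; last exact: ltW.
      by apply: mulr_ge0; [exact: mulr_ge0 | exact: ltW].
    by lra.
  have : (1 - t) * e = r * q + (x - (r + q) ^+ 2) / 2 by rewrite /e -esE -kaE; ring.
  have : (r + q) ^+ 2 = al * t + (1 - al) * (1 - t) + 2 * (r * q).
    by rewrite -r2 -q2; ring.
  by move: h hx; rewrite -/r -/q; lra.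
have -> : c - 1 + al = e by rewrite /c; ring.
rewrite le_eqVlt; apply/orP; left; apply/eqP.
have cn : c != 0 by rewrite gt_eqF.
have c1n : c - 1 != 0 by rewrite gt_eqF // subr_gt0.
have en : e != 0 by rewrite gt_eqF.
have sn : 1 - sg != 0 by rewrite gt_eqF // subr_gt0.
have sgn : sg != 0 by rewrite gt_eqF.
rewrite /l1 /l2 tE; field.
by rewrite cn c1n en sn sgn.
Qed.

(** * From the barrier to the choice of columns *)

Section Fixed.
Variables (m N k : nat) (M : 'M[R]_m) (V : 'M[R]_(m, N)) (b : 'I_m -> R).
Variables (al dl : R).
Hypotheses (sM : M^T = M) (pM : possemidef M) (p1M : possemidef (1%:M - M)).
Hypotheses (hal : forall j, M j j <= al) (al0 : 0 <= al).
Hypotheses (VV : V *m V^T = diagf b) (b0 : forall j, 0 < b j) (km : (k < m)%N).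
Hypotheses (hdl : forall j, elsymN k b j <= dl * elsym k b) (dl01 : 0 < dl < 1).
Let t := (1 - Num.sqrt dl) ^+ 2.
Let eps := (Num.sqrt (al * t) + Num.sqrt ((1 - al) * (1 - t))) ^+ 2.
Hypothesis alt : al <= t.

Let f (x : 'I_m -> R) := (detpoly (diagf x - M) (diagf b))`_k.

Lemma fcoef_maff : maff f.
Proof.
move=> u v r; rewrite /dv.
have e s : f (upd u v s) = dcoef k (diagf (upd u v 0) - M +
    s *: (delta_mx v 0 *m (delta_mx v (0 : 'I_1))^T)) (diagf b) 0.
  rewrite dcoefE scale0r addr0 /f -[upd u v s]/(fupd u v s) diagf_upd.
  by rewrite addrAC.
by rewrite !e !dcoef_affine; ring.
Qed.

(** Nonnegativity on an orthant starting strictly below x makes the coefficient nondecreasing along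
    x + r b. A zero at s would make it vanish on [-h, s], hence identically, against its degree m -
    k. *)
Lemma dcoef_pencil_gt0 x : eps < x ->
  forall s, 0 <= s -> 0 < dcoef k (diagf (fun=> x) - M) (diagf b) s.
Proof.
move=> hx s s0; have /andP[dl0 dl1] := dl01.
have sg01 : 0 < Num.sqrt dl < 1.
  by rewrite sqrtr_gt0 dl0 -sqrtr1 ltr_sqrt.
have [c [l1 [l2 [c1 l10 l20 cx hL]]]] := barrier_params al0 sg01 alt hx.
rewrite sqr_sqrtr ?(ltW dl0) // in hL.
have nf : nneg (fun=> c - l2) f.
  move=> u hu; apply: (barrier_coef_ge0 sM pM p1M hal c1 b0 l10 _ (ltnW km) hdl hL).
    by rewrite addr_gt0.
  by move=> j; rewrite -lerBlDr; exact: hu.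
set D := diagf b; set X := diagf _ - M; pose Q := (detpoly X D)^`N(k).
have QE r : Q.[r] = f (fun j => x + r * b j).
  rewrite -[LHS]/(dcoef k X D r) dcoefE /f; apply: (congr1 (fun p : {poly R} => p`_k)).
  congr (detpoly _ _); rewrite /X /D addrAC; congr (_ - _).
  apply/matrixP => i j; rewrite !mxE.
  by case: (i == j); rewrite ?mulr1n ?mulr0n ?mulr0 ?addr0.
pose B := 1 + \sum_j b j.
have B0 : 0 < B by rewrite ltr_pwDl // sumr_ge0 // => j _; exact: ltW.
have bB j : b j <= B.
  rewrite /B (bigD1 j) //= addrCA lerDl addr_ge0 // sumr_ge0 // => l _; exact: ltW.
(* Small enough that x - h b_j is at least c - l2 for every j. *)
pose h := (x - (c - l2)) / B.
have h0 : 0 < h by rewrite divr_gt0 // subr_gt0.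
have ab r : - h <= r -> above (fun=> c - l2) (fun j => x + r * b j).
  move=> hr j; rewrite -lerBlDl.
  have h1 : h * b j <= x - (c - l2).
    by rewrite /h mulrAC ler_pdivrMr // ler_wpM2l // subr_ge0 ltW.
  have := ler_wpM2r (ltW (b0 j)) hr; lra.
have mono r r' : - h <= r -> r <= r' -> Q.[r] <= Q.[r'].
  move=> hr rr; rewrite !QE; apply: (nneg_mono fcoef_maff nf (ab _ hr)) => j.
  by rewrite lerD2l ler_wpM2r // ltW.
have pdD : posdef D by exact: posdef_diagf.
rewrite -[dcoef _ _ _ _]/(Q.[s]) lt_neqAle QE nf ?andbT -?QE; last first.
  by apply: ab; rewrite (le_trans _ s0) // oppr_le0 ltW.
apply/eqP => Qs.
have : Q = 0.
  apply: (@poly_eq0_on_itv _ _ (- h) s); first by rewrite (lt_le_trans _ s0) // oppr_lt0.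
  move=> r /andP[hr rs]; apply/eqP; rewrite eq_le {2}QE nf ?andbT; last exact: ab.
  by rewrite Qs mono.
have [szQ _] : size Q = (m - k).+1 /\ 0 < lead_coef Q.
  apply: nderivn_lead; [exact/size_detpoly/posdef_unit | exact: ltnW |].
  by rewrite lead_coef_detpoly ?posdef_unit // posdef_det_gt0.
by move=> Q0; rewrite Q0 size_poly0 in szQ.
Qed.

Let good (S : {set 'I_N}) x := [/\ #|S| = k, indep_cols V S &
  forall u : 'cV[R]_m, (forall i, i \in S -> (u^T *m col i V) 0 0 = 0) ->
    qform M u <= x * \sum_i u i 0 ^+ 2].

Lemma select_gt x : eps < x -> exists S, good S x.
Proof.
move=> hx; have pdD : posdef (V *m V^T).
  by rewrite VV; exact: posdef_diagf.
have [|||S [cS iS qS]] := @selection R k m N (diagf (fun=> x) - M) V.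
- by rewrite linearB /= /diagf tr_diag_mx sM.
- exact: pdD.
- by rewrite VV; exact: dcoef_pencil_gt0.
exists S; split=> // u hu.
have [->|un0] := eqVneq u 0.
  rewrite /qform mulmx0 mxE mulr_ge0 // ?sumr_ge0 // => [|i _]; last exact: sqr_ge0.
  by apply: le_trans (ltW hx); exact: sqr_ge0.
have := qS u hu un0; rewrite qformD -scaleN1r qformZ qform_diagf mulN1r subr_gt0.
by rewrite -mulr_sumr => /ltW.
Qed.

(** Some set works for each x > eps; as there are finitely many sets, one works for all of them, and
    x tends to eps. *)
Theorem core_selection : exists S, good S eps.
Proof.
have [S hS] : exists S, forall x, eps < x -> good S x.
  apply: contrapT => h.
  have {h} hx S : exists x, eps < x /\ ~ good S x.
    apply: contrapT => hS; apply: h; exists S => x hx; apply: contrapT => ng.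
    by apply: hS; exists x.
  have [y hy] := choice hx.
  (* A set good for the least failing value would be good for its own, larger [y S]. The initial
     value eps + 1 keeps the minimum above eps. *)
  pose x0 := \big[Num.min/(eps + 1)]_S y S.
  have x0e : eps < x0.
    rewrite /x0; elim/big_ind: _ => [|a c ha hc|S _]; first by rewrite ltrDl.
      by rewrite lt_min ha hc.
    by have [] := hy S.
  have [S [cS iS qS]] := select_gt x0e.
  have [_] := hy S; apply; split=> // u hu; apply: le_trans (qS u hu) _.
  rewrite ler_wpM2r ?sumr_ge0 // => [i _|]; first exact: sqr_ge0.
  by rewrite /x0 (bigD1 S) //= ge_min lexx.
have [cS iS _] := hS (eps + 1) (ltac:(by rewrite ltrDl)).
exists S; split=> // u hu; apply/ler_addgt0Pr => d d0.
pose n := 1 + \sum_i u i 0 ^+ 2.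
have n0 : 0 < n by rewrite ltr_pwDl // sumr_ge0 // => i _; exact: sqr_ge0.
have [_ _ q] := hS (eps + d / n) (ltac:(by rewrite ltrDl divr_gt0)).
apply: le_trans (q u hu) _; rewrite mulrDl lerD2l mulrAC ler_pdivrMr // ler_wpM2l ?(ltW d0) //.
by rewrite lerDr.
Qed.

End Fixed.
End Core.

(** * Norms and pseudoinverses *)

Import classical_sets.

Section Norms.
Variable R : realType.

Definition nsq n (x : 'cV[R]_n) : R := \sum_i x i 0 ^+ 2.
Definition dot n (x y : 'cV[R]_n) : R := (x^T *m y) 0 0.

Lemma nsqE n (x : 'cV[R]_n) : nsq x = dot x x.
Proof. by rewrite /nsq /dot qform_sum_sqr. Qed.

Lemma nsq_ge0 n (x : 'cV[R]_n) : 0 <= nsq x.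
Proof. by apply: sumr_ge0 => i _; exact: sqr_ge0. Qed.

Lemma nsq_gt0 n (x : 'cV[R]_n) : x != 0 -> 0 < nsq x.
Proof. exact: sqr_sum_gt0. Qed.

Lemma nsqZ n a (x : 'cV[R]_n) : nsq (a *: x) = a ^+ 2 * nsq x.
Proof. by rewrite /nsq mulr_sumr; apply: eq_bigr => i _; rewrite mxE exprMn. Qed.

Lemma vnorm_sqr n (x : 'cV[R]_n) : vnorm x ^+ 2 = nsq x.
Proof. by rewrite sqr_sqrtr // nsq_ge0. Qed.

Lemma vnorm_ge0 n (x : 'cV[R]_n) : 0 <= vnorm x.
Proof. exact: sqrtr_ge0. Qed.

Lemma dot_mulmx n p (x : 'cV[R]_n) (A : 'M[R]_(n, p)) (y : 'cV[R]_p) :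
  dot x (A *m y) = dot (A^T *m x) y.
Proof. by rewrite /dot trmx_mul trmxK mulmxA. Qed.

Lemma CauchySchwarz n (p q : 'cV[R]_n) : dot p q ^+ 2 <= nsq p * nsq q.
Proof.
have [->|qn0] := eqVneq q 0.
  by rewrite /dot mulmx0 mxE expr0n /= mulr_ge0 ?nsq_ge0.
have q0 := nsq_gt0 qn0.
have h : 0 <= qform 1%:M (nsq q *: p + (- dot p q) *: q) by rewrite qform1 nsq_ge0.
rewrite qform_lin2 ?trmx1 // mulmx1 !qform1 -/(nsq p) -/(nsq q) -/(dot p q) in h.
have {}h : 0 <= nsq q * (nsq p * nsq q - dot p q ^+ 2) by move: h; lra.
by rewrite pmulr_rge0 // subr_ge0 in h.
Qed.

Lemma ler_sqr_cancel (a c : R) : 0 <= a -> 0 <= c -> a ^+ 2 <= c * a -> a <= c.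
Proof.
rewrite le_eqVlt => /orP[/eqP <- //|a0] c0.
by rewrite expr2 ler_pM2r.
Qed.

(** This gives [sup] its meaning as a least upper bound. The entries of a unit vector are at most 1
    in absolute value, so absolute row sums bound the image. *)
Lemma has_sup_specnorm p q (M : 'M[R]_(p, q)) :
  has_sup (fun r => exists2 x : 'cV[R]_q, vnorm x <= 1 & vnorm (M *m x) = r).
Proof.
split.
  exists (vnorm (M *m 0)), 0 => //.
  by rewrite /vnorm big1 ?sqrtr0 // => i _; rewrite mxE expr0n.
pose K := \sum_i (\sum_j `|M i j|) ^+ 2; exists (Num.sqrt K) => _ [x x1 <-].
rewrite ler_sqrt; last by apply: sumr_ge0 => i _; exact: sqr_ge0.
have xj j : `|x j 0| <= 1.
  rewrite -(@ler_pXn2r _ 2) ?nnegrE // expr1n real_normK ?num_real //.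
  apply: le_trans (_ : nsq x <= 1).
    by rewrite /nsq (bigD1 j) //= lerDl sumr_ge0 // => i _; exact: sqr_ge0.
  by rewrite -vnorm_sqr expr_le1 // vnorm_ge0.
apply: ler_sum => i _; rewrite -real_normK ?num_real //.
rewrite ler_pXn2r ?nnegrE ?sumr_ge0 // mxE.
apply: le_trans (ler_norm_sum _ _ _) _; apply: ler_sum => j _.
by rewrite normrM ler_piMr.
Qed.

Lemma specnorm_ub p q (M : 'M[R]_(p, q)) x : vnorm x <= 1 -> vnorm (M *m x) <= specnorm M.
Proof. by move=> x1; apply: (ub_le_sup (proj2 (has_sup_specnorm M))); exists x. Qed.

Lemma specnorm_ge0 p q (M : 'M[R]_(p, q)) : 0 <= specnorm M.
Proof.
apply: le_trans (vnorm_ge0 (M *m 0)) (specnorm_ub M _).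
by rewrite /vnorm big1 ?sqrtr0 // => i _; rewrite mxE expr0n.
Qed.

Lemma specnorm_bound p q (M : 'M[R]_(p, q)) x : nsq (M *m x) <= specnorm M ^+ 2 * nsq x.
Proof.
have [->|xn0] := eqVneq x 0.
  by rewrite mulmx0 /nsq !big1 ?mulr0 // => i _; rewrite mxE expr0n.
have x0 := nsq_gt0 xn0; pose y := (Num.sqrt (nsq x))^-1 *: x.
have s0 : 0 < Num.sqrt (nsq x) by rewrite sqrtr_gt0.
have sE : (Num.sqrt (nsq x))^-1 ^+ 2 = (nsq x)^-1 by rewrite exprVn sqr_sqrtr // ltW.
have y1 : vnorm y <= 1.
  rewrite -(@ler_pXn2r _ 2) ?nnegrE ?vnorm_ge0 // vnorm_sqr nsqZ sE.
  by rewrite mulVf ?expr1n // gt_eqF.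
have := specnorm_ub M y1.
rewrite -(@ler_pXn2r _ 2) ?nnegrE ?vnorm_ge0 ?specnorm_ge0 // vnorm_sqr.
by rewrite /y -scalemxAr nsqZ sE mulrC ler_pdivrMr.
Qed.

Lemma specnorm_le p q (M : 'M[R]_(p, q)) c : 0 <= c ->
  (forall x, nsq (M *m x) <= c * nsq x) -> specnorm M ^+ 2 <= c.
Proof.
move=> c0 h.
suff : specnorm M <= Num.sqrt c.
  by rewrite -(@ler_pXn2r _ 2) ?nnegrE ?specnorm_ge0 ?sqrtr_ge0 // sqr_sqrtr.
apply: ge_sup; first by have [] := has_sup_specnorm M.
move=> _ [x x1 <-]; rewrite ler_sqrt //; apply: le_trans (h x) _.
rewrite ler_piMr // -vnorm_sqr expr_le1 // vnorm_ge0 //.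
Qed.

(** [pinv] is defined by choice, so one explicit solution of the Penrose equations suffices. *)
Lemma pinv_spec p q (M : 'M[R]_(p, q)) X : is_pinv M X -> is_pinv M (pinv M).
Proof. by move=> h; apply: (@classical_sets.xgetPex _ 0 (is_pinv M)); exists X. Qed.

(** The witness is Q^T (Q Q^T)^-1 (L^T L)^-1 L^T, the pseudoinverse of a full-rank factorisation. *)
Lemma full_rank_pinv p r q (L : 'M[R]_(p, r)) (Q : 'M[R]_(r, q)) :
  L^T *m L \in unitmx -> Q *m Q^T \in unitmx -> is_pinv (L *m Q) (pinv (L *m Q)).
Proof.
move=> Lu Qu; pose G := invmx (L^T *m L); pose H := invmx (Q *m Q^T).
have GT : G^T = G by rewrite trmx_inv trmx_mul trmxK.
have HT : H^T = H by rewrite trmx_inv trmx_mul trmxK.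
pose X := Q^T *m H *m G *m L^T.
have MX : L *m Q *m X = L *m G *m L^T.
  by rewrite /X !mulmxA -[L *m Q *m Q^T]mulmxA mulmxK.
have XM : X *m (L *m Q) = Q^T *m H *m Q.
  by rewrite /X -!mulmxA [L^T *m (L *m Q)]mulmxA mulKmx.
apply: (@pinv_spec _ _ _ X); split.
- by rewrite MX -!mulmxA [L^T *m (L *m Q)]mulmxA mulKmx.
- by rewrite XM /X !mulmxA -[Q^T *m H *m Q *m Q^T]mulmxA mulmxKV.
- by rewrite MX !trmx_mul trmxK GT mulmxA.
- by rewrite XM !trmx_mul trmxK HT mulmxA.
Qed.

Lemma gram_eq0 p q (C : 'M[R]_(p, q)) : C *m C^T = 0 -> C = 0.
Proof.
move=> h; apply/matrixP => i j; move/matrixP/(_ i i): h; rewrite !mxE.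
have -> : \sum_j0 C i j0 * C^T j0 i = \sum_j0 C i j0 ^+ 2.
  by apply: eq_bigr => l _; rewrite mxE expr2.
move/eqP; rewrite psumr_eq0 => [/allP/(_ j)|l _]; last exact: sqr_ge0.
by rewrite mem_index_enum sqrf_eq0 => /(_ isT)/eqP.
Qed.

Lemma row_free_of_ker p q (A : 'M[R]_(p, q)) :
  (forall v : 'rV[R]_p, v *m A = 0 -> v = 0) -> row_free A.
Proof.
move=> h; rewrite -kermx_eq0; apply/eqP/row_matrixP => i; rewrite row0; apply: h.
by rewrite -row_mul mulmx_ker row0.
Qed.

Lemma colS_indep p N (V : 'M[R]_(p, N)) (S : {set 'I_N}) : indep_cols V S ->
  forall y : 'cV[R]_#|S|, colS V S *m y = 0 -> y = 0.
Proof.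
move=> iS y hy.
(* The selection matrix extends a vector indexed by S by zeros to all columns. *)
pose E : 'M[R]_(N, #|S|) := \matrix_(i, l) (i == enum_val l)%:R.
have VE : colS V S = V *m E.
  apply/matrixP => a l; rewrite !mxE (bigD1 (enum_val l)) //= mxE eqxx mulr1 big1 ?addr0 //.
  by move=> i il; rewrite mxE (negPf il) mulr0.
have Ey : E *m y = 0.
  apply: iS; last by rewrite mulmxA -VE.
  move=> i iNS; rewrite mxE big1 // => l _; rewrite mxE; case: eqP => [e|]; last by rewrite mul0r.
  by have := enum_valP l; rewrite -e (negPf iNS).
apply/matrixP => l c; rewrite [c]ord1 [RHS]mxE.
move/matrixP/(_ (enum_val l) 0): Ey; rewrite !mxE (bigD1 l) //= mxE eqxx mul1r.
rewrite big1 ?addr0 // => l' ll; rewrite mxE (inj_eq enum_val_inj) eq_sym (negPf ll).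
by rewrite mul0r.
Qed.

End Norms.

(** * Spectral norms of Gram matrices *)

Section Gram.
Variable R : realType.

(** With W = A^T U the matrix on the left is W^T W. As U z is fixed by U U^T, |W z|^2 = <U z, U U^T
    A W z>, and Cauchy-Schwarz bounds W by the norm of U U^T A. *)
Lemma specnorm_gram_le n d m (A : 'M[R]_(n, d)) (U : 'M[R]_(n, m)) :
  U^T *m U = 1%:M ->
  specnorm (U^T *m A *m A^T *m U) <= specnorm (U *m U^T *m A) ^+ 2.
Proof.
move=> UU; set M := U^T *m A *m A^T *m U; set s := specnorm (U *m U^T *m A).
have nU z : nsq (U *m z) = nsq z.
  by rewrite !nsqE dot_mulmx mulmxA UU mul1mx.
have hW z : nsq (A^T *m U *m z) <= s ^+ 2 * nsq z.
  set q := A^T *m U *m z.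
  have e : nsq q = dot (U *m z) (U *m U^T *m A *m q).
    have h : (U *m z)^T *m U *m U^T = (U *m z)^T.
      by rewrite trmx_mul -[z^T *m _ *m U]mulmxA UU mulmx1.
    by rewrite nsqE {1}/q -[A^T *m U *m z]mulmxA -dot_mulmx /dot !mulmxA h.
  apply: ler_sqr_cancel;
    [exact: nsq_ge0 | by apply: mulr_ge0; [exact: sqr_ge0 | exact: nsq_ge0] |].
  rewrite {1}e; apply: le_trans (CauchySchwarz _ _) _; rewrite nU.
  have := ler_wpM2l (nsq_ge0 z) (specnorm_bound (U *m U^T *m A) q).
  by rewrite -/s; lra.
rewrite -(@ler_pXn2r _ 2) ?nnegrE ?specnorm_ge0 ?sqr_ge0 //.
apply: specnorm_le; first by rewrite sqr_ge0.
move=> x; apply: ler_sqr_cancel;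
    [exact: nsq_ge0 | by apply: mulr_ge0; [exact: sqr_ge0 | exact: nsq_ge0] |].
have e : nsq (M *m x) = dot (A^T *m U *m (M *m x)) (A^T *m U *m x).
  rewrite nsqE {2}/M -[U^T *m A *m A^T *m U *m x]mulmxA -[U^T *m A *m A^T *m _]mulmxA.
  by rewrite dot_mulmx trmx_mul trmxK !mulmxA.
rewrite {1}e; apply: le_trans (CauchySchwarz _ _) _.
apply: le_trans (ler_pM (nsq_ge0 _) (nsq_ge0 _) (hW _) (hW _)) _.
by rewrite le_eqVlt; apply/orP; left; apply/eqP; ring.
Qed.

Lemma qform_le_specnorm m (M : 'M[R]_m) z : qform M z <= specnorm M * nsq z.
Proof.
have [/le_trans->//|q0] := lerP (qform M z) 0.
  by rewrite mulr_ge0 ?specnorm_ge0 ?nsq_ge0.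
rewrite -(@ler_pXn2r _ 2) ?nnegrE ?mulr_ge0 ?specnorm_ge0 ?nsq_ge0 ?(ltW q0) //.
have -> : qform M z = dot z (M *m z) by rewrite /qform /dot mulmxA.
apply: le_trans (CauchySchwarz _ _) _.
have := ler_wpM2l (nsq_ge0 z) (specnorm_bound M z); rewrite exprMn; lra.
Qed.

End Gram.

(** * Column subset selection: reduction to coordinates in the range of B *)

Theorem theorem1p3 (R : realType) (n d dB m k : nat)
  (A : 'M[R]_(n, d)) (B : 'M[R]_(n, dB))
  (U : 'M[R]_(n, m)) (b : 'rV[R]_m) :
  \rank B = m ->
  U^T *m U = 1%:M ->
  B *m B^T = U *m diag_mx b *m U^T ->
  (forall i j : 'I_m, (i <= j)%N -> b 0 j <= b 0 i) ->
  (1 <= k)%N -> (k <= m.-1)%N ->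
  let M := U^T *m A *m A^T *m U in
  let alpha := \big[Num.max/0]_(i < m) (M i i / specnorm M) in
  let delta :=
    (\sum_(S : {set 'I_m} | (#|S| == k) && [forall i in S, (i < m.-1)%N])
        \prod_(i in S) b 0 i)
    / (\sum_(S : {set 'I_m} | #|S| == k) \prod_(i in S) b 0 i) in
  let t := (1 - Num.sqrt delta) ^+ 2 in
  let eps := (Num.sqrt (alpha * t) + Num.sqrt ((1 - alpha) * (1 - t))) ^+ 2 in
  delta <= (1 - Num.sqrt alpha) ^+ 2 ->
  exists S : {set 'I_dB},
    [/\ #|S| = k, \rank (colS B S) = k &
        specnorm (A - colS B S *m pinv (colS B S) *m A) ^+ 2
        <= specnorm (A - B *m pinv B *m A) ^+ 2
           + eps * specnorm (B *m pinv B *m A) ^+ 2].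
Proof.
move=> rB UU BB bdec k1 km M alpha delta t eps hdelta.
pose V := U^T *m B; pose P := U *m U^T; pose bf j := b 0 j.
have bE : diag_mx b = diagf bf by congr diag_mx; apply/rowP => j; rewrite mxE.
have VV : V *m V^T = diagf bf.
  rewrite -bE /V trmx_mul trmxK mulmxA -[U^T *m B *m B^T]mulmxA BB !mulmxA UU mul1mx.
  by rewrite -mulmxA UU mulmx1.
(* The Gram matrix of (I - P) B vanishes, so the columns of B lie in the range of U. *)
have BUV : B = U *m V.
  apply/eqP; rewrite -subr_eq0; apply/eqP; apply: gram_eq0.
  have -> : B - U *m V = (1%:M - P) *m B by rewrite mulmxBl mul1mx /V mulmxA.
  rewrite trmx_mul mulmxA -[(_ - _) *m B *m _]mulmxA BB !mulmxA mulmxBl mul1mx.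
  by rewrite /P -[U *m U^T *m U]mulmxA UU mulmx1 subrr !mul0mx.
clearbody V.
have Vfree : row_free V.
  by rewrite /row_free eqn_leq rank_leq_row -{1}rB BUV mxrankM_maxr.
(* b_j is the squared norm of row j of V, and V has full row rank. *)
have b0 j : 0 < bf j.
  have bj : bf j = \sum_l V j l ^+ 2.
    move/matrixP/(_ j j): VV; rewrite !mxE eqxx mulr1n => <-.
    by apply: eq_bigr => l _; rewrite mxE expr2.
  rewrite lt_neqAle bj sumr_ge0 ?andbT => [|l _]; last exact: sqr_ge0.
  apply/eqP => /esym/eqP; rewrite psumr_eq0 => [/allP h|l _]; last exact: sqr_ge0.
  have : delta_mx (0 : 'I_1) j *m V = 0.
    rewrite -rowE; apply/rowP => l; rewrite !mxE; apply/eqP.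
    by rewrite -sqrf_eq0; apply: h; rewrite mem_index_enum.
  move/eqP; rewrite mulmx_free_eq0 // => /eqP/matrixP/(_ 0 j)/eqP.
  by rewrite !mxE !eqxx oner_eq0.
have m0 : (0 < m)%N by case: (m) km k1 => //=; rewrite leqn0 => /eqP ->.
have km' : (k < m)%N by rewrite -(prednK m0) ltnS.
have mlast : (m.-1 < m)%N by rewrite prednK.
pose last := Ordinal mlast.
(* Indices start at 0, so sets inside the first m - 1 indices are those avoiding [last]. *)
have deltaE : delta = elsymN k bf last / elsym k bf.
  congr (_ / _); apply: eq_bigl => S; congr (_ && _); apply/forall_inP/idP.
    by move=> h; apply/negP => /h; rewrite /= ltnn.
  move=> lS i iS; rewrite ltn_neqAle -ltnS prednK // ltn_ord andbT.
  by apply: contraNneq lS => e; rewrite (_ : last = i) //; apply: val_inj.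
have E0 : 0 < elsym k bf by apply: elsym_gt0 => //; exact: ltnW.
have dl01 : 0 < delta < 1.
  rewrite deltaE divr_gt0 ?elsymN_gt0 //= ltr_pdivrMr // mul1r elsymN_lt // k1.
  exact: ltnW.
(* The b_j decrease, so omitting the last one leaves the largest symmetric polynomial. *)
have hdl j : elsymN k bf j <= delta * elsym k bf.
  rewrite deltaE mulfVK ?gt_eqF //; apply: elsymN_le => [l|]; first exact: ltW.
  by apply: bdec; rewrite /= -ltnS prednK.
(* If the norm is 0, its inverse is 0 by convention and [M'] is 0; the bounds 0 <= M' <= I hold in
   that case as well. *)
pose Nn := specnorm M; pose M' := Nn^-1 *: M.
have Nn0 : 0 <= Nn by exact: specnorm_ge0.
have ME : M = (U^T *m A) *m (U^T *m A)^T by rewrite trmx_mul trmxK !mulmxA.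
have sM : M^T = M by rewrite ME trmx_mul trmxK.
have sM' : M'^T = M' by rewrite linearZ /= sM.
have qM z : qform M z = nsq (A^T *m U *m z).
  by rewrite ME qform_gram trmx_mul trmxK.
have pM' : possemidef M'.
  by move=> z; rewrite qformZ mulr_ge0 ?invr_ge0 // qM nsq_ge0.
have p1M' : possemidef (1%:M - M').
  move=> z; rewrite qformD -scaleN1r qformZ mulN1r subr_ge0 qform1 -/(nsq z) qformZ.
  have [N0|Nn0'] := eqVneq Nn 0; first by rewrite N0 invr0 mul0r nsq_ge0.
  rewrite mulrC ler_pdivrMr ?lt_neqAle ?Nn0 ?andbT 1?eq_sym // mulrC.
  exact: qform_le_specnorm.
have hal j : M' j j <= alpha.
  by rewrite mxE mulrC /alpha (bigD1 j) //= le_max lexx.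
have al0 : 0 <= alpha.
  rewrite /alpha; elim/big_ind: _ => // [x y hx _|i _]; first by rewrite le_max hx.
  have := pM' (delta_mx i 0); rewrite /qform trmx_delta -rowE -colE !mxE.
  by rewrite mulrC.
have al1 : alpha <= 1.
  rewrite /alpha; elim/big_ind: _ => [|x y hx hy|i _]; first exact: ler01.
    by rewrite ge_max hx hy.
  have := p1M' (delta_mx i 0); rewrite /qform trmx_delta -rowE -colE !mxE eqxx.
  by rewrite subr_ge0 mulrC.
(* The hypothesis on delta, rewritten as sqrt(alpha) <= 1 - sqrt(delta). *)
have alt : alpha <= t.
  have /andP[dl0 dl1] := dl01.
  have sa1 : Num.sqrt alpha <= 1 by rewrite -sqrtr1 ler_sqrt.
  have h : Num.sqrt delta <= 1 - Num.sqrt alpha.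
    by rewrite -[leRHS]ger0_norm ?subr_ge0 // -sqrtr_sqr ler_sqrt // sqr_ge0.
  rewrite -[leLHS]sqr_sqrtr // ler_pXn2r ?nnegrE ?sqrtr_ge0 //; first by lra.
  by have := sqrtr_ge0 alpha; lra.
have [S [cS iS qS]] := core_selection sM' pM' p1M' hal al0 VV b0 km' hdl dl01 alt.
rewrite -/t -/eps in qS.
have eps0 : 0 <= eps by exact: sqr_ge0.
have qMS u : (forall i, i \in S -> (u^T *m col i V) 0 0 = 0) ->
    qform M u <= Nn * eps * nsq u.
  move=> hu; have [N0|Nn0'] := eqVneq Nn 0.
    by have := qform_le_specnorm M u; rewrite -/Nn N0 !mul0r.
  have := qS u hu; rewrite qformZ -/(nsq u) mulrC ler_pdivrMr; last first.
    by rewrite lt_neqAle eq_sym Nn0'.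
  by move=> /le_trans; apply; rewrite [leLHS]mulrC mulrA.
exists S; pose C := colS B S.
have CE : C = U *m colS V S.
  by apply/matrixP => i l; rewrite !mxE {1}BUV mxE; apply: eq_bigr => ? _; rewrite mxE.
have Cinj (y : 'cV[R]_#|S|) : C *m y = 0 -> y = 0.
  move=> h; apply: (colS_indep iS); have := congr1 (mulmx U^T) h.
  by rewrite CE !mulmxA UU mul1mx mulmx0.
split=> //.
  rewrite -[RHS]cS -mxrank_tr; apply/eqP; apply: row_free_of_ker => v hv.
  apply: trmx_inj; rewrite trmx0; apply: Cinj; apply: trmx_inj.
  by rewrite trmx_mul trmxK hv trmx0.
have CCu : C^T *m C \in unitmx.
  apply: posdef_unit => y yn0; rewrite -{2}[C]trmxK qform_gram trmxK.
  by apply: sqr_sum_gt0; apply: contra yn0 => /eqP/Cinj/eqP.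
have [c1 c2 c3 c4] : is_pinv C (pinv C).
  have := @full_rank_pinv R _ _ _ C 1%:M CCu; rewrite mulmx1; apply.
  by rewrite trmx1 mulmx1 unitmx1.
have VVu : V *m V^T \in unitmx by rewrite VV; apply/posdef_unit/posdef_diagf.
have [b1 b2 b3 b4] : is_pinv B (pinv B).
  by rewrite BUV; apply: full_rank_pinv; rewrite ?UU ?unitmx1.
have PB : P *m B = B by rewrite BUV /P !mulmxA -[U *m U^T *m U]mulmxA UU mulmx1.
have sP : P^T = P by rewrite trmx_mul trmxK.
have PP : P *m P = P by rewrite /P mulmxA -[U *m U^T *m U]mulmxA UU mulmx1.
(* Each of the two symmetric projections fixes the range of the other. *)
have BXP : B *m pinv B = P.
  have UE : U = B *m (V^T *m invmx (V *m V^T)).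
    by rewrite {1}BUV -[RHS]mulmxA [V *m (_ *m _)]mulmxA mulmxV // mulmx1.
  have XU : B *m pinv B *m U = U by rewrite {1}UE !mulmxA b1 -mulmxA -UE.
  have h : B *m pinv B *m P = P by rewrite /P mulmxA XU.
  have : (B *m pinv B *m P)^T = P^T by rewrite h.
  by rewrite trmx_mul b3 sP mulmxA PB.
set PS := C *m pinv C.
have PC : P *m C = C by rewrite CE /P !mulmxA -[U *m U^T *m U]mulmxA UU mulmx1.
have PPS : P *m PS = PS by rewrite /PS mulmxA PC.
have PSP : PS *m P = PS by rewrite -[LHS]trmxK trmx_mul sP c3 PPS c3.
have PSPS : PS *m PS = PS by rewrite /PS !mulmxA c1.
rewrite BXP; apply: specnorm_le.
  by apply: addr_ge0; [exact: sqr_ge0 | apply: mulr_ge0 => //; exact: sqr_ge0].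
move=> x; set y1 := (A - P *m A) *m x; set y2 := (P - PS) *m (A *m x).
(* The residual splits into its parts orthogonal to and inside the range of B; Pythagoras separates
   the two error terms. *)
have -> : (A - PS *m A) *m x = y1 + y2.
  by rewrite /y1 /y2 !mulmxBl !mulmxA addrA subrK.
have y12 : dot y1 y2 = 0.
  have e : (P - PS) *m P = P - PS by rewrite mulmxBl PP PSP.
  have z0 : (P - PS) *m y1 = 0 by rewrite /y1 mulmxA mulmxBr mulmxA e subrr mul0mx.
  by rewrite /y2 dot_mulmx linearB /= sP c3 -/PS z0 /dot trmx0 mul0mx mxE.
have -> : nsq (y1 + y2) = nsq y1 + nsq y2.
  have tD : (y1 + y2)^T = y1^T + y2^T by rewrite linearD.
  rewrite !nsqE /dot tD mulmxDl !mulmxDr.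
  have y21 : (y2^T *m y1) 0 0 = 0 by rewrite dotC.
  have DE (X Y : 'M[R]_1) : (X + Y) 0 0 = X 0 0 + Y 0 0 by rewrite mxE.
  by rewrite !DE y21 [(y1^T *m y2) 0 0]y12 addr0 add0r.
rewrite mulrDl lerD //; first exact: specnorm_bound.
have Py2 : P *m y2 = y2 by rewrite /y2 mulmxA mulmxBr PP PPS.
pose z := U^T *m y2.
have y2z : y2 = U *m z by rewrite /z mulmxA -/P Py2.
have nz : nsq y2 = nsq z by rewrite y2z !nsqE dot_mulmx mulmxA UU mul1mx.
(* [y2] is orthogonal to the selected columns of B, and U carries this to the coordinates z. *)
have zperp i : i \in S -> (z^T *m col i V) 0 0 = 0.
  move=> iS'.
  have y2C : y2^T *m C = 0.
    have e1 : C^T *m P = C^T by apply: trmx_inj; rewrite trmx_mul sP trmxK PC.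
    have e2 : C^T *m PS = C^T by apply: trmx_inj; rewrite trmx_mul c3 trmxK c1.
    have e : C^T *m (P - PS) = 0 by rewrite mulmxBr e1 e2 subrr.
    by apply: trmx_inj; rewrite trmx_mul trmxK trmx0 /y2 (mulmxA C^T) e mul0mx.
  have -> : z^T *m col i V = y2^T *m col i B.
    have zE : y2^T = z^T *m U^T by rewrite -trmx_mul -y2z.
    have Bi : col i B = U *m col i V.
      by rewrite -(mulmx_col_delta V) mulmxA -BUV mulmx_col_delta.
    by rewrite zE Bi mulmxA -[z^T *m U^T *m U]mulmxA UU mulmx1.
  have -> : (y2^T *m col i B) 0 0 = (y2^T *m C) 0 (enum_rank_in iS' i).
    rewrite !mxE; apply: eq_bigr => l _; rewrite !mxE.
    by rewrite enum_rankK_in.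
  by rewrite y2C mxE.
(* Since P - PS is an orthogonal projection, |z|^2 = <A^T U z, x>. Cauchy-Schwarz and [qMS] give
   |z|^4 <= Nn eps |z|^2 |x|^2, and one factor cancels. *)
have key : nsq z <= Nn * eps * nsq x.
  apply: ler_sqr_cancel;
    [exact: nsq_ge0 | by apply: mulr_ge0; [exact: mulr_ge0 | exact: nsq_ge0] |].
  have e : nsq z = dot (A^T *m U *m z) x.
    rewrite -nz nsqE.
    have -> : dot y2 y2 = dot y2 (A *m x).
      rewrite {2}/y2 dot_mulmx linearB /= sP c3 mulmxBl Py2.
      have -> : PS *m y2 = 0 by rewrite /y2 mulmxA mulmxBr PSP PSPS subrr mul0mx.
      by rewrite subr0.
    by rewrite dot_mulmx {1}y2z mulmxA.
  rewrite {1}e; apply: le_trans (CauchySchwarz _ _) _; rewrite -qM.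
  have := ler_wpM2r (nsq_ge0 x) (qMS z zperp); lra.
rewrite nz; apply: le_trans key _; rewrite ler_wpM2r ?nsq_ge0 // mulrC ler_wpM2l //.
exact: specnorm_gram_le.
Qed.
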